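(* Assume Hypotheses 1, 2 and 3 (see context) hold. Suppose there exist constants $c,\varepsilon,\phi>0$ such that, almost surely (with respect to the observations $(Y_n)$), $a_nb_n\le c$, $\varepsilon_n\ge\varepsilon$ and $\phi_n\le\phi$ for all $n$, and suppose $\tau c^3<1$. Then, for all $N$ large enough (the threshold not depending on $n$) and all $n\ge1$, almost surely, $$\mathcal{E}_{n,N}^{p}(y_{1:n})\leq C\left\{ \log(N)+D\right\} \left(\frac{1}{\sqrt{N}}\right)^{1+3\log c/\log\tau},$$ where $$C=\frac{16}{\varepsilon^{6}c^2}\left(\frac{-1}{\log\tau}\right)\left(\frac{4c}{3\phi}\right)^{3\log c/\log\tau},\quad D=2\log\left(\frac{3\phi}{4c\tau}\right),\quad p=\left\lceil \frac{\log\left\{ \frac{4c}{3\phi\sqrt{N}}\right\}}{\log\tau}\right\rceil .$$ Here $$\mathcal{E}_{n,N}^{p}(y_{1:n})=\sup_{f:\Vert f\Vert_{\infty}=1}\mathbb{E}_{N}\left(\left|\langle H_{n}^{p}R_{1:n}\zeta-H_{n}^{p}R_{1:n}^{N}\zeta,f\rangle\right|\right),$$ the supremum being over measurable $f:E^{(n+1)\wedge p}\to\mathbb R$, and $\mathbb{E}_N$ being the expectation over the randomness of the particles only, for fixed observations $y_{1:n}$.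
   Context: Setting. $E$ is a complete separable metric space with its Borel $\sigma$-field; $v_{i:j}=(v_i,\ldots,v_j)$; $k^+=k\vee0$; $\mathcal M_+(E^k)$ and $\mathcal P(E^k)$ are the sets of (finite) nonnegative measures and of probability measures on $E^k$; $\langle\mu,f\rangle=\mu(f)=\int f\,d\mu$. $(\Lambda_n)_{n\ge0}$ is an inhomogeneous Markov chain on $E$ with initial law $\zeta\in\mathcal P(E)$ and transition kernels $Q_n$, $n\ge1$. For $n\ge1$, $\Psi_n:E^{n+1}\to(0,\infty)$ is a measurable potential function; $\Psi_n(\lambda_{0:n})$ is the conditional density at $y_n$ of an observation $Y_n$ given $\Lambda_{0:n}=\lambda_{0:n}$, $Y_{1:n-1}=y_{1:n-1}$, dependence on the observed sequence $(y_n)$ being omitted from the notation. Hypothesis 1: for all $n\ge1$ there are $\varepsilon_n\in(0,1)$ and $\xi\in\mathcal M_+(E)$ with $\varepsilon_n\xi(A)\le Q_n(\lambda,A)\le\varepsilon_n^{-1}\xi(A)$ for all Borel $A\subset E$, $\lambda\in E$. Hypothesis 2: for all $p$ large enough and all $n\ge p$ there is a measurable truncated potential $\tilde\Psi_n^p(\lambda_{n-p+1:n})$ depending on the last $p$ states only, with $|\Psi_n(\lambda_{0:n})-\tilde\Psi^p_n(\lambda_{n-p+1:n})|\le\phi_n\tau^p\{\Psi_n(\lambda_{0:n})\wedge\tilde\Psi_n^p(\lambda_{n-p+1:n})\}$ for all $\lambda_{0:n}\in E^{n+1}$, with constants $\phi_n>0$, $0<\tau<1$ not depending on $p$. For $n<p$,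 set $\tilde\Psi_n^p=\Psi_n$. Hypothesis 3: there are constants $a_n\ge1,b_n\ge1$ (not depending on $p$) with $1/a_n\le\Psi_n(\lambda_{0:n})\le b_n$ and $1/a_n\le\tilde\Psi_n^p(\lambda_{(n-p+1)^+:n})\le b_n$ for all $\lambda_{0:n}\in E^{n+1}$. The constants $a_n,b_n,\phi_n$ may depend on the realisation $y_{1:n}$. Operators. For $\mu\in\mathcal M_+(E^n)$, $\gamma_n\mu(f)=\int\mu(d\lambda_{0:n-1})Q_n(\lambda_{n-1},d\lambda_n)\Psi_n(\lambda_{0:n})f(\lambda_{0:n})$, $R_n\mu(f)=\gamma_n\mu(f)/\gamma_n\mu(1)$, and $R_{1:n}\mu=R_n\cdots R_1\mu$. $H_n^p$ maps a measure on $E^{n+1}$ to its marginal on the last $p$ components $\lambda_{n-p+1:n}$ if $n\ge p$, and is the identity if $p>n$. Particle operators. For a probability measure $\mu'$, $S^N(\mu')=\frac1N\sum_{i=1}^N\delta_{Z_i}$ with $Z_1,\dots,Z_N$ i.i.d. of law $\mu'$. Let $\bar Q_n(\lambda_{0:n-1},d\lambda_{0:n}')=\delta_{\lambda_{0:n-1}}(d\lambda'_{0:n-1})Q_n(\lambda_{n-1},d\lambda_n')$ and $\Psi_n\cdot\nu(f)=\nu(\Psi_nf)/\nu(\Psi_n)$. For $\mu\in\mathcal P(E^n)$, $R_n^N\mu=\Psi_n\cdot S^N(\bar Q_n\mu)$, a random weighted empirical measure on $E^{n+1}$. $R_{1:n}^N\zeta=R_n^NR_{n-1}^N\cdots R_1^N\zeta$,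 where at each step the sample is drawn afresh, conditionally independently given the previous steps. *)

(* Defs.v *)
From HB Require Import structures.
From mathcomp Require Import all_boot all_order all_algebra.
From mathcomp Require Import all_classical all_reals all_analysis.

Set Implicit Arguments.
Unset Strict Implicit.
Unset Printing Implicit Defensive.

Import Order.TTheory GRing.Theory Num.Theory.
Import numFieldNormedType.Exports.

Local Open Scope classical_set_scope.
Local Open Scope ring_scope.

#[short(type="completeMetricMeasurableType")]
HB.structure Definition CompleteMetricMeasurable (R : realType)
    (d : measure_display) :=
  {T of Complete T & Metric R T & Measurable d T}.

Definition separable_borel (R : realType) (d : measure_display)
    (E : completeMetricMeasurableType R d) : Prop :=
  (exists2 D : set E, countable D & dense D) /\
  (@measurable d E = <<s @open E >>).

Section paths.
Context {T : Type}.

Definition extend (n : nat) (x : n.-tuple T) (e : T) : n.+1.-tuple T :=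
  [tuple of rcons x e].

Definition final (n : nat) (x : n.+1.-tuple T) : T := tnth x ord_max.

(* The subtraction is truncated: [n.+1 - p] is (n - p + 1)^+, so this is the
   tuple of the last p components of x_{0:n} if p <= n, and x_{0:n} itself if
   p > n. *)
Definition window (p n : nat) (x : n.+1.-tuple T) : (minn n.+1 p).-tuple T :=
  [tuple tnth x (inord (n.+1 - p + i)) | i < minn n.+1 p].

(* (u_0, ..., u_n) *)
Definition from0 (u : nat -> T) (n : nat) : n.+1.-tuple T :=
  [tuple u i | i < n.+1].

(* (u_1, ..., u_n) *)
Definition from1 (u : nat -> T) (n : nat) : n.-tuple T :=
  [tuple u i.+1 | i < n].

End paths.

(* A measure on paths is represented by its underlying set function; sums,
   integrals and ratios below are the genuine ones as soon as the potentials
   are measurable, positive and bounded. The step index n of the chain is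
   written n.+1 in the operators, which exist for n >= 1 only; the values Q 0
   and Psi 0 are never used. *)
Section operators.
Local Open Scope ereal_scope.
Context {R : realType} {d : measure_display} {E : measurableType d}.
Implicit Types (zeta : probability E R) (Q : nat -> R.-pker E ~> E).
Implicit Types (n N p : nat).

Local Notation pathmeas n := (set (n.-tuple E) -> \bar R).

Definition initial zeta : pathmeas 1 := pushforward zeta (fun e => [tuple e]).

Definition gamma Q (Psi : forall n, n.+1.-tuple E -> R) n
    (mu : pathmeas n.+1) : pathmeas n.+2 := fun A =>
  \int[mu]_x \int[Q n.+1 (final x)]_e
    (Psi n.+1 (extend x e) * \1_A (extend x e))%:E.

Definition R_op Q (Psi : forall n, n.+1.-tuple E -> R) n
    (mu : pathmeas n.+1) : pathmeas n.+2 := fun A =>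
  gamma Q Psi mu A / gamma Q Psi mu setT.

(* R_{1:n} zeta *)
Fixpoint R_iter zeta Q (Psi : forall n, n.+1.-tuple E -> R) n :
    pathmeas n.+1 :=
  match n with
  | 0 => initial zeta
  | m.+1 => R_op Q Psi (@R_iter zeta Q Psi m)
  end.
Arguments R_iter zeta Q Psi n : clear implicits.

Definition H_op p n (mu : pathmeas n.+1) : pathmeas (minn n.+1 p) :=
  pushforward mu (@window E p n).
Arguments H_op p {n} mu.

Definition Q_bar Q n (mu : pathmeas n.+1) : pathmeas n.+2 := fun A =>
  \int[mu]_x Q n.+1 (final x) [set e | A (extend x e)].

Definition boltzmann n (g : n.-tuple E -> R) (nu : pathmeas n) : pathmeas n :=
  fun A => (\int[nu]_x (g x * \1_A x)%:E) / (\int[nu]_x (g x)%:E).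

(* S^N for the sample z *)
Definition empirical n N (z : N.-tuple (n.-tuple E)) : pathmeas n := fun A =>
  (N%:R^-1)%:E * \sum_(i < N) \d_(tnth z i) A.

(* E[F(Z_1, ..., Z_N)] for Z_1, ..., Z_N i.i.d. of law nu, as the integral of
   F against the N-fold product of nu, iterated one variable at a time *)
Fixpoint iid_expectation n (nu : pathmeas n) N :
    (N.-tuple (n.-tuple E) -> \bar R) -> \bar R :=
  match N with
  | 0 => fun F => F [tuple]
  | M.+1 => fun F =>
      \int[nu]_z @iid_expectation n nu M (fun s => F [tuple of z :: s])
  end.

(* E_N[G(R^N_{1:n} zeta)], the expectation over the particle system: given the
   first n steps, R^N_{n+1} mu = Psi_{n+1} . S^N(Qbar_{n+1} mu) with a fresh
   sample drawn from Qbar_{n+1} mu, where mu = R^N_{1:n} zeta. *)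
Fixpoint particle_expectation zeta Q (Psi : forall n, n.+1.-tuple E -> R) N n :
    (pathmeas n.+1 -> \bar R) -> \bar R :=
  match n with
  | 0 => fun G => G (initial zeta)
  | m.+1 => fun G =>
      @particle_expectation zeta Q Psi N m (fun mu =>
        iid_expectation (Q_bar Q mu) (fun z : N.-tuple (m.+2.-tuple E) =>
          G (boltzmann (Psi m.+1) (empirical z))))
  end.

Definition pairing n (mu : pathmeas n) (f : n.-tuple E -> R) : R :=
  fine (\int[mu]_x (f x)%:E).

Definition sup_norm n (f : n.-tuple E -> R) : \bar R :=
  ereal_sup [set `|f x|%:E | x in setT].

Definition particle_error zeta Q (Psi : forall n, n.+1.-tuple E -> R)
    N p n : \bar R :=
  ereal_sup [set particle_expectation zeta Q Psi N (fun mu : pathmeas n.+1 =>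
      `|pairing (H_op p (R_iter zeta Q Psi n)) f - pairing (H_op p mu) f|%:E)
    | f in [set f : (minn n.+1 p).-tuple E -> R |
             measurable_fun setT f /\ sup_norm f = 1]].

End operators.

Section model.
Context {R : realType} {d dY dO : measure_display} {E : measurableType d}
  {Y : measurableType dY} {Omega : measurableType dO}.
Implicit Types (Q : nat -> R.-pker E ~> E) (n p : nat).

(* (Lambda_n)_{n >= 0} is a Markov chain with initial law zeta and kernels
   Q_n, and Psi_n(y_{1:n}, lambda_{0:n}) is the conditional density at y_n,
   with respect to nu_n, of the observation Y_n given
   Lambda_{0:n} = lambda_{0:n} and Y_{1:n-1} = y_{1:n-1}. *)
Definition observed_chain (P : probability Omega R) (zeta : probability E R) Q
    (nu : nat -> {sigma_finite_measure set Y -> \bar R})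
    (Psi : forall n, n.-tuple Y -> n.+1.-tuple E -> R)
    (Lambda : nat -> Omega -> E) (Yobs : nat -> Omega -> Y) : Prop :=
  [/\ forall n, measurable_fun setT (Lambda n),
      forall n, measurable_fun setT (Yobs n),
      forall A, measurable A -> P (Lambda 0 @^-1` A) = zeta A,
      (forall n (A : set (n.+1.-tuple E)) (B : set E),
        measurable A -> measurable B ->
        let past := [set w | A (from0 (Lambda ^~ w) n)] in
        (P (past `&` Lambda n.+1 @^-1` B) =
          \int[P]_(w in past) Q n.+1 (Lambda n w) B)%E) &
      (forall n (A : set (n.-tuple Y * n.+2.-tuple E)) (B : set Y),
        measurable A -> measurable B ->
        let past :=
          [set w | A (from1 (Yobs ^~ w) n, from0 (Lambda ^~ w) n.+1)] in
        (P (past `&` Yobs n.+1 @^-1` B) =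
          \int[P]_(w in past) \int[nu n.+1]_(y in B)
            (Psi n.+1 (extend (from1 (Yobs ^~ w) n) y)
                      (from0 (Lambda ^~ w) n.+1))%:E)%E)].

Definition potential (Psi : forall n, n.-tuple Y -> n.+1.-tuple E -> R) :
    Prop :=
  forall n, (0 < n)%N ->
    measurable_fun setT
      (fun yx : n.-tuple Y * n.+1.-tuple E => Psi n yx.1 yx.2) /\
    (forall y x, 0 < Psi n y x).

Definition hypothesis1 Q (eps : nat -> R) : Prop :=
  forall n, (0 < n)%N -> 0 < eps n < 1 /\
    exists xi : {finite_measure set E -> \bar R},
      forall x (A : set E), measurable A ->
        ((eps n)%:E * xi A <= Q n x A)%E /\
        (Q n x A <= ((eps n)^-1)%:E * xi A)%E.

(* Psit p n y is the truncated potential, a function of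
   lambda_{(n-p+1)^+ : n}. "For p large enough" is p >= p0, where p0, like tau,
   depends neither on n nor on the observations y. *)
Definition hypothesis2 (Psi : forall n, n.-tuple Y -> n.+1.-tuple E -> R)
    (Psit : forall p n, n.-tuple Y -> (minn n.+1 p).-tuple E -> R)
    (phi : forall n, n.-tuple Y -> R) (tau : R) (p0 : nat) : Prop :=
  [/\ 0 < tau < 1,
      (forall n (y : n.-tuple Y), (0 < n)%N -> 0 < phi n y),
      (forall p n (y : n.-tuple Y), (p0 <= p)%N -> (0 < n)%N -> (p <= n)%N ->
        measurable_fun setT (Psit p n y) /\
        forall x : n.+1.-tuple E,
          `|Psi n y x - Psit p n y (window p x)| <=
          phi n y * tau ^+ p *
          Num.min (Psi n y x) (Psit p n y (window p x))) &
      (forall p n (y : n.-tuple Y) (x : n.+1.-tuple E),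
        (p0 <= p)%N -> (0 < n)%N -> (n < p)%N ->
        Psit p n y (window p x) = Psi n y x)].

Definition hypothesis3 (Psi : forall n, n.-tuple Y -> n.+1.-tuple E -> R)
    (Psit : forall p n, n.-tuple Y -> (minn n.+1 p).-tuple E -> R)
    (a b : forall n, n.-tuple Y -> R) (p0 : nat) : Prop :=
  forall n (y : n.-tuple Y), (0 < n)%N ->
    [/\ 1 <= a n y, 1 <= b n y &
        forall x : n.+1.-tuple E,
          (a n y)^-1 <= Psi n y x <= b n y /\
          forall p, (p0 <= p)%N ->
            (a n y)^-1 <= Psit p n y (window p x) <= b n y].

End model.

Section constants.
Context {R : realType}.
Implicit Types c eps phi tau : R.

Definition bound_C c eps phi tau : R :=
  16 / (eps ^+ 6 * c ^+ 2) * (- 1 / ln tau) *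
  (4 * c / (3 * phi)) `^ (3 * ln c / ln tau).

Definition bound_D c phi tau : R := 2 * ln (3 * phi / (4 * c * tau)).

(* The ceiling is an integer, positive for N large since 0 < tau < 1;
   [absz] turns it into a natural number. *)
Definition bound_p c phi tau (N : nat) : nat :=
  `|Num.ceil (ln (4 * c / (3 * phi * Num.sqrt N%:R)) / ln tau)|%N.

End constants.

(* Main.v *)
From HB Require Import structures.
Require Import Defs.
From mathcomp Require Import all_boot all_order all_algebra.
From mathcomp Require Import all_classical all_reals all_analysis.
From mathcomp Require Import measurable_realfun zify ring lra.

(* Fix the observations. Hypothesis 2, used for every p >= p0, shows that
   Psi_n(x) <= exp(G tau^q) Psi_n(x') as soon as x and x' agree on their last q
   states; the truncated potentials play no other role, and G = 0 if c = 1.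
   These factors having a finite product, the backward Feynman-Kac functions
   h_{k,n} = E[Psi_{k+1} ... Psi_n | lambda_{0:k}] oscillate by at most a
   constant factor, and, under the conditional law, two pasts which agree on
   the last q states can be coupled at the next step with a probability at
   least S_q^-2 (eps^4 S_0^-2 if q = 0), where S_q tends to 1 geometrically.
   The number of states on
   which the pasts agree therefore dominates a transient Markov chain on nat,
   and the oscillation at time k of the conditional expectation of a function
   of the last p states at time n is at most twice the probability that this
   chain, started from 0, is below p at time n - k. Summed over k, these
   oscillations are at most 2p / T_0 with T_0 > 0 independent of n, N and p.
   The error is the telescopic sum over k of the sampling errors of the k-th
   step, each propagated to time n; the k-th term is at most a constant times
   the oscillation at time k divided by sqrt N. Hence the error is at most
   A p / sqrt N. If c > 1 the factor c^(3p) of the claimed bound absorbs A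
   since p tends to infinity with N; if c = 1, then G = 0 and
   A = 2 / eps^6 <= 32 / eps^6. *)

Set Implicit Arguments.
Unset Strict Implicit.
Unset Printing Implicit Defensive.

Import Order.TTheory GRing.Theory Num.Theory.
Import numFieldNormedType.Exports.

Local Open Scope classical_set_scope.
Local Open Scope ring_scope.

(** * Integrals of bounded measurable functions *)

Section set_functions.
Local Open Scope ereal_scope.
Context {R : realType} {d : measure_display} {T : measurableType d}.
Implicit Types (mu nu : set T -> \bar R) (f g : T -> \bar R).
Import HBNNSimple.

(** Simple functions see a set function through measurable sets only. A path measure, a bare set
    function, can thus be replaced by any measure that agrees with it there. *)
Lemma eq_integral_setfun mu nu f :
  (forall A, measurable A -> mu A = nu A) -> \int[mu]_x f x = \int[nu]_x f x.
Proof.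
move=> e; have es (h : {nnsfun T >-> R}) : sintegral mu h = sintegral nu h.
  by apply: eq_fsbigr => r _; rewrite e.
rewrite /integral; congr (ereal_sup _ - ereal_sup _);
  by apply: eq_imagel => h _; exact: es.
Qed.

End set_functions.

Section integral_monotone.
Local Open Scope ereal_scope.
Context {R : realType} {d : measure_display} {T : measurableType d}.
Variable mu : {measure set T -> \bar R}.

(* The nested integrands of [particle_expectation] are not known to be
   measurable; but the integral of any nonnegative function is the supremum of
   the integrals of the simple functions below it. *)
Lemma le_integral_ge0 (f g : T -> \bar R) :
  (forall x, 0 <= f x) -> (forall x, f x <= g x) ->
  \int[mu]_x f x <= \int[mu]_x g x.
Proof.
move=> f0 fg; rewrite !ge0_integralTE//; last by move=> x; exact: le_trans (fg x).
apply: le_ereal_sup => _ [h hf <-]; exists h => // x.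
exact: le_trans (hf x) (fg x).
Qed.

End integral_monotone.

Section bounded_measurable.
Context {R : realType} {d : measure_display} {T : measurableType d}.
Implicit Types (f g : T -> R) (m : probability T R).

Definition bdm f := measurable_fun setT f /\ exists M, forall x, `|f x| <= M.

(** The argument is a bare set function, so that path measures qualify before they are known to be
    measures. *)
Definition mean (mu : set T -> \bar R) f : R := fine (\int[mu]_x (f x)%:E).

Lemma bdm_cst r : bdm (fun=> r).
Proof. by split; [exact: measurable_cst | exists `|r|]. Qed.

Lemma bdmD f g : bdm f -> bdm g -> bdm (fun x => f x + g x).
Proof.
move=> [mf [M hM]] [mg [K hK]]; split; first exact: measurable_funD.
by exists (M + K) => x; apply: le_trans (ler_normD _ _) _; exact: lerD.
Qed.

Lemma bdmM f g : bdm f -> bdm g -> bdm (fun x => f x * g x).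
Proof.
move=> [mf [M hM]] [mg [K hK]]; split; first exact: measurable_funM.
by exists (M * K) => x; rewrite normrM; apply: ler_pM.
Qed.

Lemma bdmZ r f : bdm f -> bdm (fun x => r * f x).
Proof. by move=> hf; apply: bdmM => //; exact: bdm_cst. Qed.

Lemma bdmB f g : bdm f -> bdm g -> bdm (fun x => f x - g x).
Proof.
move=> hf hg; rewrite (_ : (fun x => _) = (fun x => f x + (-1) * g x)).
  by apply: bdmD => //; exact: bdmZ.
by apply/funext => x; rewrite mulN1r.
Qed.

Lemma bdm_indic (A : set T) : measurable A -> bdm (\1_A : T -> R).
Proof.
move=> mA; split; first exact: measurable_indic.
by exists 1 => x; rewrite indicE ger0_norm ?ler0n// lern1 leq_b1.
Qed.

Lemma bdm_cvg (f_ : nat -> T -> R) f M :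
  (forall n, measurable_fun setT (f_ n)) -> (forall n x, `|f_ n x| <= M) ->
  (forall x, f_ ^~ x @ \oo --> f x) -> bdm f.
Proof.
move=> mf bf cf; split.
  by apply: (measurable_fun_cvg mf) => x _; exact: cf.
exists M => x.
have h : (fun n => `|f_ n x|) @ \oo --> `|f x| by apply: cvg_norm; exact: cf.
rewrite -(cvg_lim _ h)//; apply: limr_le; first by apply/cvg_ex; eexists; exact: h.
by apply: nearW => n; exact: bf.
Qed.

Lemma bdm_integrable m f : bdm f -> m.-integrable setT (EFin \o f).
Proof.
move=> [mf [M hM]].
apply: (@le_integrable _ _ _ m setT _ _ (EFin \o cst M)) => //.
- exact/measurable_EFinP.
- move=> x _ /=; rewrite lee_fin; apply: le_trans (hM x) _.
  exact: ler_norm.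
- exact: finite_measure_integrable_cst.
Qed.

Lemma mean_EFin m f : bdm f -> (\int[m]_x (f x)%:E)%E = (mean m f)%:E.
Proof.
move=> hf; rewrite /mean fineK//.
by apply: integrable_fin_num => //; exact: bdm_integrable.
Qed.

Lemma meanD m f g : bdm f -> bdm g ->
  mean m (fun x => f x + g x) = mean m f + mean m g.
Proof. by move=> hf hg; apply: RintegralD => //; exact: bdm_integrable. Qed.

Lemma meanZ m r f : bdm f -> mean m (fun x => r * f x) = r * mean m f.
Proof. by move=> hf; apply: RintegralZl => //; exact: bdm_integrable. Qed.

Lemma mean_cst m r : mean m (fun=> r) = r.
Proof.
have -> : mean m (fun=> r) = r * fine (m setT) by exact: Rintegral_cst.
by rewrite (@probability_setT _ _ _ m) mulr1.
Qed.

Lemma mean_ge0 m f : (forall x, 0 <= f x) -> 0 <= mean m f.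
Proof. by move=> f0; apply: Rintegral_ge0. Qed.

Lemma mean_cvg m (f_ : nat -> T -> R) f M :
  (forall n, measurable_fun setT (f_ n)) -> (forall n x, `|f_ n x| <= M) ->
  (forall x, f_ ^~ x @ \oo --> f x) ->
  (fun n => mean m (f_ n)) @ \oo --> mean m f.
Proof.
move=> mf bf cf.
have hf : bdm f by apply: bdm_cvg bf cf.
suff : (fun n => \int[m]_x (f_ n x)%:E)%E @ \oo --> (mean m f)%:E.
  by move/fine_cvg.
rewrite -mean_EFin//.
apply: (@dominated_cvg _ _ _ m _ _ (fun n => EFin \o f_ n) (EFin \o f) (EFin \o cst M)) => //.
- by move=> n; exact/measurable_EFinP.
- by move=> x _; apply: cvg_EFin => //; [exact: nearW|exact: cf].
- exact: finite_measure_integrable_cst.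
- by move=> n x _ /=; rewrite lee_fin.
Qed.

(** Abstract expectations: they compose and reweight easily, and each of them comes from a
    probability measure ([daniell_probability]). *)
Definition daniell (L : (T -> R) -> R) : Prop :=
  [/\ forall f g, bdm f -> bdm g -> L (fun x => f x + g x) = L f + L g,
      forall r f, bdm f -> L (fun x => r * f x) = r * L f,
      forall f, bdm f -> (forall x, 0 <= f x) -> 0 <= L f,
      L (fun=> 1) = 1 &
      forall (f_ : nat -> T -> R) f M,
        (forall n, measurable_fun setT (f_ n)) ->
        (forall n x, `|f_ n x| <= M) -> (forall x, f_ ^~ x @ \oo --> f x) ->
        (fun n => L (f_ n)) @ \oo --> L f].

Lemma daniell_mean m : daniell (mean m).
Proof.
split.
- exact: meanD.
- exact: meanZ.
- by move=> f _; exact: mean_ge0.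
- exact: mean_cst.
- exact: mean_cvg.
Qed.

Section daniell_theory.
Variable L : (T -> R) -> R.
Hypothesis hL : daniell L.

Let LD f g : bdm f -> bdm g -> L (fun x => f x + g x) = L f + L g.
Proof. by case: hL => + _ _ _ _; exact. Qed.

Let LZ r f : bdm f -> L (fun x => r * f x) = r * L f.
Proof. by case: hL => _ + _ _ _; exact. Qed.

Let Lge0 f : bdm f -> (forall x, 0 <= f x) -> 0 <= L f.
Proof. by case: hL => _ _ + _ _; exact. Qed.

Lemma daniell1 : L (fun=> 1) = 1. Proof. by case: hL. Qed.

Lemma daniell0 : L (fun=> 0) = 0.
Proof.
rewrite (_ : (fun=> 0) = (fun=> 0 * 1 : R)); last by apply/funext => x; rewrite mul0r.
by rewrite LZ ?mul0r//; exact: bdm_cst.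
Qed.

Lemma daniell_cst r : L (fun=> r) = r.
Proof.
rewrite (_ : (fun=> r) = (fun=> r * 1 : R)); last by apply/funext => x; rewrite mulr1.
by rewrite LZ ?daniell1 ?mulr1//; exact: bdm_cst.
Qed.

Lemma daniellB f g : bdm f -> bdm g -> L (fun x => f x - g x) = L f - L g.
Proof.
move=> hf hg.
rewrite (_ : (fun x => _) = (fun x => f x + (-1) * g x)); last first.
  by apply/funext => x; rewrite mulN1r.
by rewrite LD ?LZ ?mulN1r//; exact: bdmZ.
Qed.

Lemma le_daniell f g : bdm f -> bdm g -> (forall x, f x <= g x) -> L f <= L g.
Proof.
move=> hf hg fg; rewrite -subr_ge0 -daniellB//; apply: Lge0; first exact: bdmB.
by move=> x; rewrite subr_ge0.
Qed.

Lemma daniell_sum (I : Type) (s : seq I) (P : pred I) (F : I -> T -> R) :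
  (forall i, bdm (F i)) ->
  bdm (fun x => \sum_(i <- s | P i) F i x) /\
  L (fun x => \sum_(i <- s | P i) F i x) = \sum_(i <- s | P i) L (F i).
Proof.
move=> hF; elim: s => [|i s [ih1 ih2]].
  under eq_fun do rewrite big_nil.
  by rewrite big_nil daniell0; split => //; exact: bdm_cst.
under eq_fun do rewrite big_cons.
rewrite big_cons; case: (P i) => //.
by split; [exact: bdmD | rewrite LD ?ih2].
Qed.

Lemma daniell_cvg (f_ : nat -> T -> R) f M :
  (forall n, measurable_fun setT (f_ n)) ->
  (forall n x, `|f_ n x| <= M) -> (forall x, f_ ^~ x @ \oo --> f x) ->
  (fun n => L (f_ n)) @ \oo --> L f.
Proof. by case: hL => _ _ _ _; apply. Qed.

End daniell_theory.

(** * Representation of Daniell functionals by probability measures *)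

Section daniell_representation.
Variable L : (T -> R) -> R.
Hypothesis hL : daniell L.

(** The maximum with 0 matters off the measurable sets only, where [L] of an indicator is
    unconstrained; a measure must be nonnegative on every set. *)
Definition daniell_measure (A : set T) : \bar R := (Num.max 0 (L \1_A))%:E.

Lemma daniell_measureE A : measurable A -> daniell_measure A = (L \1_A)%:E.
Proof.
move=> mA; congr EFin; apply/max_idPr; case: hL => _ _ + _ _; apply; first exact: bdm_indic.
by move=> x; rewrite indicE ler0n.
Qed.

Let dm0 : daniell_measure set0 = 0%E.
Proof. by rewrite daniell_measureE// indic0 (daniell0 hL). Qed.

Let dm_ge0 A : (0 <= daniell_measure A)%E.
Proof. by rewrite lee_fin le_max lexx. Qed.

Let dm_sigma : semi_sigma_additive daniell_measure.
Proof.
move=> F mF tF mUF; rewrite daniell_measureE//.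
rewrite (_ : (fun n => _) =
    EFin \o (fun n => L (fun x => \sum_(0 <= i < n) \1_(F i) x))); last first.
  apply/funext => n /=; rewrite (proj2 (daniell_sum hL _ _ _)).
    by rewrite -sumEFin; apply: eq_bigr => i _; rewrite daniell_measureE.
  by move=> i; exact: bdm_indic.
(* By disjointness a partial sum of indicators is again an indicator, hence bounded by 1, so that
   the continuity of [L] applies. *)
have sumE n x : \sum_(0 <= i < n) \1_(F i) x = \1_(\big[setU/set0]_(i < n) F i) x :> R.
  elim: n => [|n ih]; first by rewrite big_geq// big_ord0 indic0.
  rewrite big_nat_recr//= ih big_ord_recr/= !indicE in_setU.
  have [xF|xF] := boolP (x \in F n); last by rewrite addr0 orbF.
  rewrite orbT memNset ?add0r// -bigcup_mkord => -[i /= ltin Fix].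
  have /trivIsetP/(_ i n Logic.I Logic.I) := tF.
  rewrite ltn_eqF// => /(_ isT); apply/eqP/set0P; exists x; split => //.
  by rewrite inE in xF.
apply: cvg_EFin; first exact: nearW.
apply: (@daniell_cvg L hL _ _ 1).
- move=> n; under eq_fun do rewrite sumE.
  by apply: measurable_indic; apply: bigsetU_measurable.
- by move=> n x; rewrite sumE indicE ger0_norm ?ler0n// lern1 leq_b1.
- move=> x; under eq_fun do rewrite sumE.
  have [[i _ Fix]|nF] := pselect ((\bigcup_n F n) x).
    apply: cvg_near_cst; exists i.+1 => // n /= ltin.
    rewrite !indicE !mem_set//; first by exists i.
    by rewrite -bigcup_mkord; exists i.
  apply: cvg_near_cst; apply: nearW => n.
  rewrite !indicE !memNset// -bigcup_mkord => -[i _ Fix].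
  by apply: nF; exists i.
Qed.

HB.instance Definition _ := isMeasure.Build _ T R daniell_measure dm0 dm_ge0 dm_sigma.

Let dmT : daniell_measure setT = 1%E.
Proof. by rewrite daniell_measureE// indicT (daniell1 hL). Qed.

HB.instance Definition _ := Measure_isProbability.Build _ T R daniell_measure dmT.

Let mean_daniell_indic A : measurable A ->
  mean daniell_measure \1_A = L \1_A.
Proof.
move=> mA; rewrite /mean integral_indic// setIT.
by rewrite -[RHS]/(fine (L \1_A)%:E) -daniell_measureE.
Qed.

Import HBNNSimple.

Let mean_daniell_nnsfun (g : {nnsfun T >-> R}) : mean daniell_measure g = L g.
Proof.
pose s := finmap.enum_fset (fset_set (g @` setT)).
have -> : (g : T -> R) = fun x => \sum_(i < size s)
    (nth 0 s i * \1_(g @^-1` [set nth 0 s i]) x).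
  by apply/funext => x; exact: fimfunEord.
have hb r : bdm (\1_(g @^-1` [set r]) : T -> R) by exact: bdm_indic.
have hsum (i : 'I_(size s)) :
  bdm (fun x => nth 0 s i * \1_(g @^-1` [set nth 0 s i]) x) by exact: bdmZ.
rewrite (proj2 (daniell_sum hL _ _ _))// (proj2 (daniell_sum (daniell_mean _) _ _ _))//.
apply: eq_bigr => i _; rewrite meanZ// mean_daniell_indic//.
by case: hL => _ -> //.
Qed.

Lemma mean_daniell f : bdm f -> mean daniell_measure f = L f.
Proof.
(* Nonnegative functions are limits of simple ones, on which the two functionals agree; a bounded
   function becomes nonnegative once its bound is added. *)
have ge0 g : bdm g -> (forall x, 0 <= g x) -> mean daniell_measure g = L g.
  move=> [mg [M hM]] g0.
  have meg : measurable_fun setT (EFin \o g) by exact/measurable_EFinP.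
  pose g_ := nnsfun_approx measurableT meg.
  have cg x : (fun n => g_ n x) @ \oo --> g x.
    have : (EFin \o (fun n => g_ n x)) @ \oo --> (g x)%:E.
      by apply: (cvg_nnsfun_approx measurableT meg) => // y _; rewrite lee_fin.
    by move/fine_cvg.
  have bg n x : `|g_ n x| <= M.
    rewrite ger0_norm//; apply: le_trans (hM x); rewrite ger0_norm//.
    rewrite -lee_fin /g_ nnsfun_approxE; apply: le_approx => // y _.
    by rewrite lee_fin.
  have mg_ n : measurable_fun setT (g_ n) by [].
  have c1 := mean_cvg (m := daniell_measure) mg_ bg cg.
  have c2 := daniell_cvg hL mg_ bg cg.
  have e : (fun n => mean daniell_measure (g_ n)) = (fun n => L (g_ n)).
    by apply/funext => n; exact: mean_daniell_nnsfun.
  by rewrite e in c1; exact: (cvg_unique _ c1 c2).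
move=> hf; have [_ [M hM]] := hf.
have hf' : bdm (fun x => f x + M) by exact: (bdmD hf (bdm_cst M)).
have [LD _ _ _ _] := hL.
have := ge0 _ hf'; rewrite (LD _ _ hf (bdm_cst M)) (meanD _ hf (bdm_cst M)).
rewrite mean_cst (daniell_cst hL) => /(_ _)/addIr; apply => x.
by rewrite -lerBlDr sub0r; have := hM x; rewrite ler_norml => /andP[].
Qed.

Lemma daniell_probability :
  exists m : probability T R, forall f, bdm f -> mean m f = L f.
Proof. by exists daniell_measure; exact: mean_daniell. Qed.

End daniell_representation.
End bounded_measurable.

(** * Kernels and laws *)

Section kernels.
Context {R : realType} {d d' d'' : measure_display}.
Context {X : measurableType d} {Y : measurableType d'} {Z : measurableType d''}.

Definition kernel_at (k : R.-pker Y ~> Z) (y : Y) : set Z -> \bar R := k y.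

HB.instance Definition _ k y := Measure.on (kernel_at k y).

HB.instance Definition _ k y :=
  Measure_isProbability.Build _ Z R (kernel_at k y) (prob_kernel y).

Variables (k : R.-pker Y ~> Z) (u : X -> Y).
Hypothesis mu : measurable_fun setT u.

(** Pulling [k] back along [u] makes the integral of F(x, z) against k(u x, dz) an integral against
    a kernel with source [X]. *)
Definition kernel_comp (x : X) : {measure set Z -> \bar R} := k (u x).

Let kernel_comp_measurable U : measurable U ->
  measurable_fun setT (kernel_comp ^~ U).
Proof.
by move=> mU; apply: (measurableT_comp (f := k ^~ U)) => //; exact: measurable_kernel.
Qed.

HB.instance Definition _ := isKernel.Build _ _ X Z R kernel_comp kernel_comp_measurable.

HB.instance Definition _ := Kernel_isProbability.Build _ _ X Z R kernel_comp
  (fun x => prob_kernel (u x)).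

Lemma bdm_comp (v : X -> Y) (f : Y -> R) :
  measurable_fun setT v -> bdm f -> bdm (f \o v).
Proof.
move=> mv [mf [M hM]]; split; first exact: measurableT_comp.
by exists M => x; exact: hM.
Qed.

Lemma bdm_section (F : X * Z -> R) x : bdm F -> bdm (fun z => F (x, z)).
Proof.
move=> [mF [M hM]]; split; last by exists M.
by apply: (measurableT_comp (f := F)) => //; exact: pair1_measurable.
Qed.

Lemma bdm_kernel (F : X * Z -> R) : bdm F ->
  bdm (fun x => mean (k (u x)) (fun z => F (x, z))).
Proof.
move=> hF; have [mF [M hM]] := hF.
have hs x := bdm_section x hF.
have bM z x : `|mean (k z) (fun y => F (x, y))| <= M.
  have h := daniell_mean (kernel_at k z).
  rewrite ler_norml -{1}(daniell_cst h (- M)) -{2}(daniell_cst h M).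
  apply/andP; split; apply: (le_daniell h) => //; try exact: bdm_cst;
    by move=> y; have := hM (x, y); rewrite ler_norml => /andP[].
split; last by exists M.
(* The shift by [M] makes the integrand nonnegative, so that its partial integral against a kernel
   is measurable. *)
rewrite (_ : (fun x => _) = (fun x =>
    fine (\int[kernel_comp x]_z ((F (x, z) + M)%:E)) - M)); last first.
  apply/funext => x.
  rewrite -[fine _]/(mean (kernel_at k (u x)) (fun z => F (x, z) + M)).
  by rewrite meanD ?mean_cst ?addrK//; exact: bdm_cst.
apply: measurable_funB; last exact: measurable_cst.
apply: measurableT_comp; first exact: fine_measurable.
apply: (measurable_fun_integral_finite_kernel (fun xz => (F xz + M)%:E) kernel_comp).
  by move=> z; rewrite lee_fin -lerBlDr sub0r; have := hM z; rewrite ler_norml => /andP[].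
by apply/measurable_EFinP; apply: measurable_funD => //; exact: measurable_cst.
Qed.

End kernels.

Section represent.
Context {R : realType} {d : measure_display} {T : measurableType d}.

Definition represents (mu : set T -> \bar R) (L : (T -> R) -> R) : Prop :=
  forall A, measurable A -> mu A = (L \1_A)%:E.

Definition is_law (mu : set T -> \bar R) : Prop :=
  exists m : probability T R, forall A, measurable A -> mu A = m A.

Lemma eq_mean (mu nu : set T -> \bar R) f :
  (forall A, measurable A -> mu A = nu A) -> mean mu f = mean nu f.
Proof. by move=> e; rewrite /mean (eq_integral_setfun _ e). Qed.

Lemma mean_indic (m : probability T R) A : measurable A -> mean m \1_A = fine (m A).
Proof. by move=> mA; rewrite /mean integral_indic// setIT. Qed.

(** The common route for all operators below: they are computed on measurable sets, and the
    representing probability extends the formula to bounded measurable functions. *)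
Lemma is_law_daniell mu L : represents mu L -> daniell L ->
  is_law mu /\ forall f, bdm f -> mean mu f = L f.
Proof.
move=> hmu hL; have [m hm] := daniell_probability hL.
have e A : measurable A -> mu A = m A.
  move=> mA; rewrite hmu// -hm; last exact: bdm_indic.
  by rewrite mean_indic// fineK// fin_num_measure.
by split; [exists m | move=> f hf; rewrite (eq_mean _ e) hm].
Qed.

Lemma daniell_is_law mu : is_law mu -> daniell (mean mu).
Proof.
move=> [m hm]; rewrite (_ : mean mu = mean m); first exact: daniell_mean.
by apply/funext => f; exact: eq_mean.
Qed.

(** Change of law with density g / L(g); it serves the update R_n, the Boltzmann transform and the
    conditional laws of the coupling. *)
Lemma daniell_reweight (L : (T -> R) -> R) g : daniell L -> bdm g ->
  (forall x, 0 <= g x) -> 0 < L g -> daniell (fun f => L (fun x => g x * f x) / L g).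
Proof.
move=> [LD LZ L0 L1 Lc] hg g0 Lg; split.
- move=> f h hf hh; rewrite -mulrDl -LD; try exact: bdmM.
  by under eq_fun do rewrite mulrDr.
- move=> r f hf; rewrite mulrA -LZ; last exact: bdmM.
  by under eq_fun do rewrite mulrCA.
- move=> f hf f0; apply: divr_ge0; last exact: ltW.
  by apply: L0 => [|x]; [exact: bdmM | exact: mulr_ge0].
- by under eq_fun do rewrite mulr1; rewrite divff// gt_eqF.
- move=> f_ f M mf bf cf; apply: cvgM; last exact: cvg_cst.
  have [mg [K hK]] := hg.
  apply: (Lc _ _ (K * M)).
  + by move=> n; exact: measurable_funM.
  + by move=> n x; rewrite normrM; exact: ler_pM.
  + by move=> x; apply: cvgM; [exact: cvg_cst | exact: cf].
Qed.

Lemma daniell_empirical N (z : N.+1.-tuple T) :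
  daniell (fun f : T -> R => N.+1%:R^-1 * \sum_(i < N.+1) f (tnth z i)).
Proof.
split.
- by move=> f g _ _; rewrite big_split/= mulrDr.
- by move=> r f _; rewrite -mulr_sumr mulrCA.
- move=> f _ f0; apply: mulr_ge0; first by rewrite invr_ge0 ler0n.
  exact: sumr_ge0.
- by rewrite sumr_const card_ord mulVf// pnatr_eq0.
- move=> f_ f M _ _ cf; apply: cvgM; first exact: cvg_cst.
  by apply: cvg_big => [|i _]; [exact: add_continuous | exact: cf].
Qed.

End represent.

Section pushforward.
Context {R : realType} {d d' : measure_display}.
Context {X : measurableType d} {Y : measurableType d'}.

Lemma is_law_pushforward (mu : set X -> \bar R) (u : X -> Y) :
  is_law mu -> measurable_fun setT u ->
  is_law (pushforward mu u) /\
  forall f, bdm f -> mean (pushforward mu u) f = mean mu (f \o u).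
Proof.
move=> [m hm] mu'; apply: is_law_daniell.
  move=> A mA; have mB : measurable (u @^-1` A) by rewrite -[_ @^-1` _]setTI; exact: mu'.
  rewrite /pushforward hm// (_ : \1_A \o u = \1_(u @^-1` A)).
    by rewrite (eq_mean _ hm) mean_indic// fineK// fin_num_measure.
  by apply/funext => x; rewrite /= !indicE; congr (_%:R); apply/idP/idP; rewrite !inE.
have [LD LZ L0 L1 Lc] := daniell_is_law (ex_intro _ m hm).
have hc f : bdm f -> bdm (f \o u) by exact: bdm_comp.
split => //.
- by move=> f g hf hg; apply: (LD (f \o u) (g \o u)); exact: hc.
- by move=> r f hf; apply: (LZ r (f \o u)); exact: hc.
- by move=> f hf f0; apply: L0 => [|x /=]; [exact: hc|exact: f0].
- move=> f_ f M mf bf cf; apply: (Lc (fun n => f_ n \o u) (f \o u) M).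
  + by move=> n; exact: measurableT_comp.
  + by move=> n x; exact: bf.
  + by move=> x; exact: cf.
Qed.

End pushforward.

(** * The operators of the model *)

Section tuples.
Context {d : measure_display} {E : measurableType d}.

Lemma tnth_extend_lt n (x : n.-tuple E) e (i : 'I_n.+1) (ltin : (i < n)%N) :
  tnth (extend x e) i = tnth x (Ordinal ltin).
Proof. by rewrite !(tnth_nth e) /= nth_rcons size_tuple ltin. Qed.

Lemma final_extend n (x : n.-tuple E) e : final (extend x e) = e.
Proof. by rewrite /final (tnth_nth e) /= nth_rcons size_tuple ltnn eqxx. Qed.

Lemma measurable_final n : measurable_fun setT (@final E n).
Proof. exact: measurable_tnth. Qed.

Lemma measurable_extend n :
  measurable_fun setT (fun xe : n.-tuple E * E => extend xe.1 xe.2).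
Proof.
apply/measurable_fun_tnthP => i; have [ltin|] := ltnP i n.
  rewrite (_ : _ \o _ = (fun xe : n.-tuple E * E => tnth xe.1 (Ordinal ltin))).
    by apply: (measurableT_comp (f := fun x => tnth x _)) => //; exact: measurable_tnth.
  by apply/funext => xe /=; exact: tnth_extend_lt.
move=> leni; have -> : i = ord_max.
  by apply/val_inj/eqP; rewrite eqn_leq leni -ltnS ltn_ord.
rewrite (_ : _ \o _ = snd); first exact: measurable_snd.
by apply/funext => xe /=; exact: final_extend.
Qed.

Lemma measurable_select m n (s : 'I_m -> 'I_n) :
  measurable_fun setT (fun x : n.-tuple E => [tuple tnth x (s i) | i < m]).
Proof.
apply/measurable_fun_tnthP => i.
rewrite (_ : _ \o _ = (fun x => tnth x (s i))); first exact: measurable_tnth.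
by apply/funext => x /=; rewrite tnth_mktuple.
Qed.

End tuples.

Section operators.
Context {R : realType} {d : measure_display} {E : measurableType d}.
Variable Q : nat -> R.-pker E ~> E.

(** The one-step operator on functions of paths, dual to [Q_bar]. *)
Definition kstep n (F : n.+2.-tuple E -> R) (x : n.+1.-tuple E) : R :=
  mean (Q n.+1 (final x)) (fun e => F (extend x e)).

Lemma bdm_extend n (F : n.+1.-tuple E -> R) x : bdm F -> bdm (fun e => F (extend x e)).
Proof.
move=> hF; apply: (@bdm_section _ _ _ _ _ (fun xe => F (extend xe.1 xe.2)) x).
by apply: (bdm_comp (f := F)) => //; exact: measurable_extend.
Qed.

Lemma bdm_kstep n (F : n.+2.-tuple E -> R) : bdm F -> bdm (kstep F).
Proof.
move=> hF; apply: (@bdm_kernel _ _ _ _ _ _ _ _ _ _ (fun xe => F (extend xe.1 xe.2))).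
  exact: measurable_final.
by apply: (bdm_comp (f := F)) => //; exact: measurable_extend.
Qed.

Lemma daniell_kstep_at n (x : n.+1.-tuple E) : daniell (fun F => kstep F x).
Proof.
have [LD LZ L0 L1 Lc] := daniell_mean (kernel_at (Q n.+1) (final x)).
split.
- by move=> f g hf hg; apply: LD; exact: bdm_extend.
- by move=> r f hf; apply: LZ; exact: bdm_extend.
- by move=> f hf f0; apply: L0 => //; exact: bdm_extend.
- exact: L1.
- move=> f_ f M mf bf cf; apply: (Lc _ _ M) => // k.
  have hk : bdm (f_ k) by split => //; exists M.
  by have [] := bdm_extend x hk.
Qed.

Lemma daniell_kstep n (mu : set (n.+1.-tuple E) -> \bar R) :
  is_law mu -> daniell (fun F => mean mu (kstep F)).
Proof.
move=> hmu; have [LD LZ L0 L1 Lc] := daniell_is_law hmu.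
have hx x := daniell_kstep_at x.
split.
- move=> f g hf hg; rewrite -LD; try exact: bdm_kstep.
  by congr mean; apply/funext => x; have [-> ] := hx _ x.
- move=> r f hf; rewrite -LZ; try exact: bdm_kstep.
  by congr mean; apply/funext => x; have [_ -> ] := hx _ x.
- move=> f hf f0; apply: L0 => [|x]; first exact: bdm_kstep.
  by have [_ _ h _ _] := hx _ x; exact: h.
- by rewrite -[RHS]L1; congr mean; apply/funext => x; exact: daniell1 (hx _ x).
- move=> f_ f M mf bf cf; apply: (Lc _ _ M).
  + move=> k; have hk : bdm (f_ k) by split => //; exists M.
    by have [] := bdm_kstep hk.
  + move=> k x; have hk : bdm (f_ k) by split => //; exists M.
    rewrite ler_norml -{1}(daniell_cst (hx _ x) (- M)) -{2}(daniell_cst (hx _ x) M).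
    apply/andP; split; apply: (le_daniell (hx _ x)) => //; try exact: bdm_cst;
      by move=> y; have := bf k y; rewrite ler_norml => /andP[].
  + by move=> x; apply: (daniell_cvg (hx _ x) mf bf cf).
Qed.

Lemma is_law_Q_bar n (mu : set (n.+1.-tuple E) -> \bar R) : is_law mu ->
  is_law (Q_bar Q mu) /\ forall F, bdm F -> mean (Q_bar Q mu) F = mean mu (kstep F).
Proof.
move=> hmu; apply: is_law_daniell; last exact: daniell_kstep.
have [m hm] := hmu; move=> A mA.
rewrite /Q_bar (eq_integral_setfun _ hm) (eq_mean _ hm) -mean_EFin; last first.
  exact/bdm_kstep/bdm_indic.
apply: eq_integral => x _.
have mAx : measurable [set e | A (extend x e)].
  rewrite -[[set _ | _]]setTI.
  by apply: (measurableT_comp (f := fun xe => extend xe.1 xe.2)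
    (@measurable_extend _ E n.+1) (pair1_measurable x)).
rewrite -[LHS]fineK; last exact: (fin_num_measure (kernel_at (Q n.+1) (final x))).
congr EFin; rewrite -[LHS](mean_indic (kernel_at (Q n.+1) (final x)) mAx).
congr mean; apply/funext => e; rewrite !indicE; congr (_%:R).
Qed.

Section potential.
Variables (Psi : forall n, n.+1.-tuple E -> R).
Arguments Psi : clear implicits.
Hypothesis Psi_bdm : forall n, bdm (Psi n.+1).
Hypothesis Psi_gt0 : forall n x, 0 < Psi n.+1 x.

Lemma daniell_gt0 (d' : measure_display) (T : measurableType d') (L : (T -> R) -> R) g l :
  daniell L -> bdm g -> 0 < l -> (forall x, l <= g x) -> 0 < L g.
Proof.
move=> hL hg l0 hl; apply: lt_le_trans l0 _.
by rewrite -{1}(daniell_cst hL l); apply: (le_daniell hL) => //; exact: bdm_cst.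
Qed.

Lemma is_law_R_op n l (mu : set (n.+1.-tuple E) -> \bar R) : is_law mu ->
  0 < l -> (forall x, l <= Psi n.+1 x) ->
  is_law (R_op Q Psi mu) /\ forall F, bdm F -> mean (R_op Q Psi mu) F =
    mean mu (kstep (fun x => Psi n.+1 x * F x)) / mean mu (kstep (@Psi n.+1)).
Proof.
move=> hmu l0 hl; have hL := daniell_kstep hmu.
have g0 : 0 < mean mu (kstep (@Psi n.+1)) by exact: (daniell_gt0 hL (Psi_bdm n) l0 hl).
apply: is_law_daniell; last first.
  by apply: (daniell_reweight hL) => // x; exact/ltW.
have gammaE A : measurable A -> gamma Q Psi mu A =
    (mean mu (kstep (fun x => Psi n.+1 x * \1_A x)))%:E.
  move=> mA; have hF : bdm (fun x => @Psi n.+1 x * \1_A x).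
    by apply: bdmM => //; exact: bdm_indic.
  have [m hm] := hmu.
  rewrite /gamma (eq_integral_setfun _ hm) (eq_mean _ hm) -mean_EFin; last exact: bdm_kstep.
  apply: eq_integral => x _.
  by rewrite -[RHS](mean_EFin (kernel_at (Q n.+1) (final x)) (bdm_extend x hF)).
move=> A mA; rewrite /R_op !gammaE//.
have -> : (fun x => @Psi n.+1 x * \1_setT x) = @Psi n.+1.
  by apply/funext => x; rewrite indicT mulr1.
by rewrite inver gt_eqF.
Qed.

End potential.

End operators.

Section boltzmann.
Context {R : realType} {d : measure_display} {E : measurableType d}.

(** The sample size is a successor, an empty sample having no mass to normalize; the factor 1/N
    cancels. *)
Lemma is_law_boltzmann_empirical n N (g : n.-tuple E -> R)
    (z : N.+1.-tuple (n.-tuple E)) : bdm g -> (forall x, 0 < g x) ->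
  is_law (boltzmann g (empirical z)) /\
  forall F, bdm F -> mean (boltzmann g (empirical z)) F =
    (\sum_(i < N.+1) g (tnth z i) * F (tnth z i)) / \sum_(i < N.+1) g (tnth z i).
Proof.
move=> hg g0; have hL := @daniell_empirical R _ _ _ z.
have [hemp he] : is_law (@empirical R _ _ _ _ z) /\
    forall f : n.-tuple E -> R, bdm f ->
    mean (empirical z) f = N.+1%:R^-1 * \sum_(i < N.+1) f (tnth z i).
  apply: is_law_daniell => // A mA.
  rewrite /empirical EFinM; congr (_ * _)%E.
  by rewrite -sumEFin; apply: eq_bigr => i _; rewrite diracE indicE.
have s0 : 0 < \sum_(i < N.+1) g (tnth z i).
  rewrite big_ord_recl; apply: ltr_wpDr => //; apply: sumr_ge0 => i _; exact/ltW.
have N0 : 0 < N.+1%:R^-1 :> R by rewrite invr_gt0 ltr0n.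
have hL' := daniell_reweight hL hg (fun x => ltW (g0 x)) (mulr_gt0 N0 s0).
have [m hm] := hemp.
have [h1 h2] : is_law (boltzmann g (empirical z)) /\ forall F, bdm F ->
    mean (boltzmann g (empirical z)) F =
    (N.+1%:R^-1 * \sum_(i < N.+1) (g (tnth z i) * F (tnth z i))) /
    (N.+1%:R^-1 * \sum_(i < N.+1) g (tnth z i)).
  apply: is_law_daniell => // A mA.
  have hgA : bdm (fun x => g x * \1_A x) by apply: bdmM => //; exact: bdm_indic.
  rewrite /boltzmann !(eq_integral_setfun _ hm) !mean_EFin//.
  rewrite -!(eq_mean _ hm) !he// inver mulf_eq0 (gt_eqF N0) (gt_eqF s0)//.
split => // F hF; rewrite h2// -mulf_div divff ?mul1r// gt_eqF//.
Qed.

End boltzmann.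

(** * Stability of the Feynman-Kac flow *)

Section occupation.
Context {R : realType}.
Variables (al T : nat -> R) (p : nat).
Hypothesis T_gt0 : forall q, 0 < T q.
Hypothesis T_le1 : forall q, T q <= 1.
Hypothesis al01 : forall q, 0 <= al q <= 1.
Hypothesis TS : forall q, T q = al q * T q.+1.

(* [renewal j q / 2] is the probability that the Markov chain on nat which
   moves from i to i+1 with probability [al i], and to 0 otherwise, is below
   [p] at time j when started from q. *)
Fixpoint renewal (j q : nat) : R :=
  match j with
  | 0 => 2 * (q < p)%:R
  | j'.+1 => (1 - al q) * renewal j' 0 + al q * renewal j' q.+1
  end.

Lemma renewal_ge0 j q : 0 <= renewal j q.
Proof.
elim: j q => [|j ih] q /=; first by rewrite mulr_ge0.
by have /andP[a0 a1] := al01 q; rewrite addr_ge0 ?mulr_ge0 ?subr_ge0.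
Qed.

(* The chain never returns to 0 with probability at least [T 0], and visits
   {0, ..., p-1} at most p times between two returns. *)
Lemma sum_renewal_le M : \sum_(j < M) renewal j 0 <= 2 * p%:R / T 0.
Proof.
(* A bound on the total from q: at most p - q visits below p, each counted 2, before the first
   return to 0, which has probability at most 1 - [T q] and then costs [V 0]. *)
pose V q : R := 2 * (p - q)%:R + (1 - T q) * (2 * p%:R / T 0).
have V0 : V 0 = 2 * p%:R / T 0.
  by rewrite /V subn0; have := T_gt0 0; move: (T 0) => t t0; field; rewrite gt_eqF.
suff bound m q : \sum_(j < m) renewal j q <= V q by rewrite -V0.
elim: m q => [|m ih] q.
  rewrite big_ord0; apply: addr_ge0; first exact: mulr_ge0.
  apply: mulr_ge0; first by rewrite subr_ge0.
  by apply: divr_ge0; [exact: mulr_ge0 | exact: ltW].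
rewrite big_ord_recl /= big_split/= -!mulr_sumr.
have /andP[a0 a1] := al01 q.
apply: (@le_trans _ _ (2 * (q < p)%:R + ((1 - al q) * V 0 + al q * V q.+1))).
  by rewrite lerD2l; apply: lerD; apply: ler_wpM2l; rewrite ?subr_ge0.
rewrite V0 /V (TS q); set v := 2 * p%:R / T 0.
have h : (q < p)%:R + al q * (p - q.+1)%:R <= (p - q)%:R.
  have [qp|qp] := ltnP q p; last first.
    by rewrite (eqP (leqW qp : p - q.+1 == 0)%N) mulr0 addr0.
  by rewrite -(subnSK qp) -natr1 addrC lerD2r ler_piMl.
rewrite -subr_ge0 [X in 0 <= X](_ : _ =
    2 * ((p - q)%:R - ((q < p)%:R + al q * (p - q.+1)%:R))); last by ring.
by rewrite mulr_ge0// subr_ge0.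
Qed.

End occupation.

(** * Paths with a common recent past *)

Section agree.
Context {d : measure_display} {E : measurableType d}.

(** The truncated subtraction makes this plain equality as soon as [q >= n]; [q = 0] is no
    constraint. *)
Definition agree (q n : nat) (x x' : n.-tuple E) : Prop :=
  forall i : 'I_n, (n - q <= i)%N -> tnth x i = tnth x' i.

Lemma agree_sym q n (x x' : n.-tuple E) : agree q x x' -> agree q x' x.
Proof. by move=> h i hi; rewrite h. Qed.

Lemma agree0 n (x x' : n.-tuple E) : agree 0 x x'.
Proof. by move=> i; rewrite subn0 leqNgt ltn_ord. Qed.

Lemma agree_all q n (x x' : n.-tuple E) : (n <= q)%N -> agree q x x' -> x = x'.
Proof.
by move=> nq h; apply: eq_from_tnth => i; apply: h; rewrite (eqP (nq : n - q == 0)%N).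
Qed.

Lemma agree_final q n (x x' : n.+1.-tuple E) : agree q.+1 x x' -> final x = final x'.
Proof. by move=> h; apply: h; rewrite subSS leq_subr. Qed.

Lemma agree_extend q n (x x' : n.-tuple E) e :
  agree q x x' -> agree q.+1 (extend x e) (extend x' e).
Proof.
move=> h i; rewrite subSS => hi; have [ltin|] := ltnP i n.
  by rewrite !tnth_extend_lt; apply: h.
move=> leni; have -> : i = ord_max.
  by apply/val_inj/eqP; rewrite eqn_leq leni -ltnS ltn_ord.
by rewrite -![tnth _ _]/(final _) !final_extend.
Qed.

Lemma agree_window p n (x x' : n.+1.-tuple E) : agree p x x' -> window p x = window p x'.
Proof.
move=> h; apply: eq_from_tnth => i; rewrite !tnth_mktuple; apply: h.
have := ltn_ord i; rewrite leq_min => /andP[i1 i2].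
rewrite inordK ?leq_addr//; move: i1 i2; move: (nat_of_ord i) => {i} j j1 j2.
by clear -j1 j2; lia.
Qed.

End agree.

(** * Contraction for overlapping laws *)

Section overlap.
Context {R : realType} {d : measure_display} {T : measurableType d}.

(** An analytic form of coupling: as L dominates al L', a fraction al of the mass can be matched at
    common points, where the difference is at most a; on the rest it is at most b. *)
Lemma overlap_contraction (L L' : (T -> R) -> R) (f f' : T -> R) (al a b : R) :
  daniell L -> daniell L' -> bdm f -> bdm f' -> 0 <= al ->
  (forall F, bdm F -> (forall x, 0 <= F x) -> al * L' F <= L F) ->
  (forall x, f x - f' x <= a) -> (forall x x', f x - f' x' <= b) ->
  L f - L' f' <= (1 - al) * b + al * a.
Proof.
move=> hL hL' hf hf' al0 LL' fa fb.
have [[LD LZ _ _ _] [LD' LZ' _ _ _]] := (hL, hL').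
have fK x : f x <= L' f' + b.
  have : L' (fun=> f x - b) <= L' f'.
    by apply: (le_daniell hL') => // [|y]; [exact: bdm_cst | have := fb x y; lra].
  by rewrite (daniell_cst hL'); lra.
have hc := bdm_cst (R := R) (T := T).
(* [L' f' + b] bounds [f] from above, so the domination applies to their difference. *)
have := LL' (fun x => (L' f' + b) - f x) (bdmB (hc _) hf).
rewrite (daniellB hL) ?(daniellB hL')// !(daniell_cst hL) !(daniell_cst hL').
have : L' f <= L' (fun x => f' x + a).
  by apply: (le_daniell hL') => // [|x]; [exact: bdmD | have := fa x; lra].
rewrite LD'// (daniell_cst hL') => h1 /(_ _) h2.
have {}h2 : al * (L' f' + b - L' f) <= L' f' + b - L f.
  by apply: h2 => x; rewrite subr_ge0.
have : al * L' f <= al * (L' f' + a) by exact: ler_wpM2l.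
by move: h2; rewrite !mulrBr !mulrDr; lra.
Qed.

End overlap.

(** Comparison of normalized integrals: r is lost once in the numerator and once in the normalizing
    constant, hence the square. *)
Lemma ratio_quotient_le {R : realType} (r a a' b b' : R) :
  0 < r -> 0 <= a -> 0 <= a' -> 0 < b -> 0 < b' -> a' <= r * a -> b <= r * b' ->
  r^-1 ^+ 2 * (a' / b') <= a / b.
Proof.
move=> r0 a0 a'0 b0 b'0 ha hb; rewrite ler_pdivlMr//.
rewrite (_ : _ * b = (a' / r) * (b / (r * b'))); last by field; rewrite !gt_eqF.
rewrite -[leRHS]mulr1; apply: ler_pM.
- by rewrite divr_ge0// ltW.
- by rewrite divr_ge0 ?mulr_ge0 ?(ltW b0) ?(ltW r0) ?(ltW b'0).
- by rewrite ler_pdivrMr// mulrC.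
- by rewrite ler_pdivrMr ?mul1r// mulr_gt0.
Qed.

(** * Backward Feynman-Kac functions *)

Section feynman_kac.
Context {R : realType} {d : measure_display} {E : measurableType d}.
Variables (Q : nat -> R.-pker E ~> E) (Psi : forall n, n.+1.-tuple E -> R).
Arguments Psi : clear implicits.
Hypothesis Psi_bdm : forall n, bdm (Psi n.+1).
Hypothesis Psi_lb : forall n, exists2 l, 0 < l & forall x, l <= Psi n.+1 x.

(** E[Psi_{k+1} ... Psi_{k+j} F_{k+j} | lambda_{0:k}]; F = 1 gives h_{k,k+j}. *)
Fixpoint fk (F : forall k, k.+1.-tuple E -> R) j k : k.+1.-tuple E -> R :=
  match j with
  | 0 => F k
  | j'.+1 => kstep Q (fun x => Psi k.+1 x * fk F j' x)
  end.

Lemma bdm_fk F j k : (forall k, bdm (F k)) -> bdm (@fk F j k).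
Proof.
move=> hF; elim: j k => [|j ih] k /=; first exact: hF.
by apply: bdm_kstep; apply: bdmM.
Qed.

Definition fk1 := @fk (fun _ _ => 1).
Arguments fk1 : clear implicits.

Lemma bdm_fk1 j k : bdm (fk1 j k).
Proof. by apply: bdm_fk => i; exact: bdm_cst. Qed.

Lemma fk1_lb j k : exists2 l, 0 < l & forall x, l <= fk1 j k x.
Proof.
elim: j k => [|j ih] k; first by exists 1.
have [l l0 hl] := ih k.+1; have [l' l'0 hl'] := Psi_lb k.
exists (l' * l); first exact: mulr_gt0.
move=> x; rewrite -(daniell_cst (daniell_kstep_at Q x) (l' * l)).
apply: (le_daniell (daniell_kstep_at Q x)); first exact: bdm_cst.
  by apply: bdmM => //; exact: bdm_fk1.
by move=> y; apply: ler_pM => //; exact: ltW.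
Qed.

Lemma fk1_gt0 j k x : 0 < fk1 j k x.
Proof. by have [l l0 hl] := fk1_lb j k; exact: lt_le_trans (hl x). Qed.

Lemma Psi_gt0 k x : 0 < Psi k.+1 x.
Proof. by have [l l0 hl] := Psi_lb k; exact: lt_le_trans (hl x). Qed.

Lemma bdm_inv (d' : measure_display) (T : measurableType d') (f : T -> R) l :
  bdm f -> 0 < l -> (forall x, l <= f x) -> bdm (fun x => (f x)^-1).
Proof.
move=> [mf _] l0 hl; split.
  rewrite (_ : (fun x => _) = fun x => expR (- ln (f x))).
    apply: measurableT_comp => //; apply: measurable_funN.
    by apply: measurableT_comp => //; exact: measurable_ln.
  by apply/funext => x; rewrite expRN lnK// posrE; exact: lt_le_trans (hl x).
exists l^-1 => x; have fx := lt_le_trans l0 (hl x).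
by rewrite ger0_norm ?invr_ge0; [rewrite lef_pV2 | exact: ltW].
Qed.

(** Conditional expectation of F_{k+j} given lambda_{0:k} and the observations up to time k + j. *)
Definition fk_ratio F j k x := @fk F j k x / fk1 j k x.

Lemma bdm_fk_ratio F j k : (forall k, bdm (F k)) -> bdm (@fk_ratio F j k).
Proof.
move=> hF; apply: bdmM; first exact: bdm_fk.
by have [l l0 hl] := fk1_lb j k; apply: bdm_inv l0 hl; exact: bdm_fk1.
Qed.

Lemma fkE F j k x : @fk F j k x = fk1 j k x * fk_ratio F j x.
Proof. by rewrite /fk_ratio mulrCA divff ?mulr1// gt_eqF// fk1_gt0. Qed.

Section mixing.
Variables (eps c : R) (r S : nat -> R).
Hypothesis eps_gt0 : 0 < eps.
Hypothesis eps_le1 : eps <= 1.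
Hypothesis Q_mix : forall n x x' (f : E -> R), bdm f -> (forall e, 0 <= f e) ->
  mean (Q n.+1 x) f <= eps ^- 2 * mean (Q n.+1 x') f.
Hypothesis Psi_c : forall n x x', Psi n.+1 x <= c * Psi n.+1 x'.
Hypothesis Psi_agree : forall n q (x x' : n.+2.-tuple E), agree q x x' ->
  Psi n.+1 x <= r q * Psi n.+1 x'.
Hypothesis S_ge1 : forall q, 1 <= S q.
Hypothesis rS : forall q, r q.+1 * S q.+1 <= S q.

(** Price of changing the past in the next kernel: none if the last state is shared, the mixing
    constant otherwise. *)
Definition mix q := if q == 0%N then eps ^- 2 else 1.
(** [S q] dominates the products of the [r i] over i > q, so this bounds the oscillation of
    [fk1 j k] uniformly in the horizon j. *)
Definition mixing_ratio q := mix q * S q.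

Lemma mix_ge1 q : 1 <= mix q.
Proof.
by rewrite /mix; case: eqP => // _; rewrite invf_ge1 ?exprn_gt0// exprn_ile1// ltW.
Qed.

Lemma mixing_ratio_ge1 q : 1 <= mixing_ratio q.
Proof. by rewrite /mixing_ratio; apply: mulr_ege1 => //; exact: mix_ge1. Qed.

Lemma le_mean_mix n q (x x' : n.+1.-tuple E) (f : E -> R) : agree q x x' ->
  bdm f -> (forall e, 0 <= f e) ->
  mean (Q n.+1 (final x)) f <= mix q * mean (Q n.+1 (final x')) f.
Proof.
move=> h hf f0; rewrite /mix; case: q h => [|q] h; first exact: Q_mix.
by rewrite mul1r (agree_final h).
Qed.

Lemma bdm_potential_fk1 j k : bdm (fun x => Psi k.+1 x * fk1 j k.+1 x).
Proof. by apply: bdmM => //; exact: bdm_fk1. Qed.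

Lemma potential_fk1_ge0 j k x : 0 <= Psi k.+1 x * fk1 j k.+1 x.
Proof. by rewrite ltW// mulr_gt0 ?Psi_gt0 ?fk1_gt0. Qed.

Lemma potential_fk1_ratio j k q (x x' : k.+1.-tuple E) e :
  (forall q (x x' : k.+2.-tuple E), agree q.+1 x x' ->
     fk1 j k.+1 x <= S q.+1 * fk1 j k.+1 x') ->
  agree q x x' ->
  Psi k.+1 (extend x e) * fk1 j k.+1 (extend x e) <=
  S q * (Psi k.+1 (extend x' e) * fk1 j k.+1 (extend x' e)).
Proof.
move=> ih h; have h' := agree_extend e h.
apply: (@le_trans _ _ ((r q.+1 * Psi k.+1 (extend x' e)) *
                       (S q.+1 * fk1 j k.+1 (extend x' e)))).
  apply: ler_pM; [exact/ltW/Psi_gt0|exact/ltW/fk1_gt0|exact: Psi_agree|exact: ih].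
by rewrite mulrACA ler_wpM2r// potential_fk1_ge0.
Qed.

(** The kernel is paid for at the first step only. Afterwards both pasts receive the same new
    states, so their agreement grows by one at each step and the potentials contribute r_{q+1},
    r_{q+2}, and so on. *)
Lemma fk1_ratio j k q (x x' : k.+1.-tuple E) : agree q x x' ->
  fk1 j k x <= mixing_ratio q * fk1 j k x'.
Proof.
elim: j k q x x' => [|j ih] k q x x' h.
  by rewrite /fk1 /= mulr1 mixing_ratio_ge1.
have ih' q' (y y' : k.+2.-tuple E) : agree q'.+1 y y' ->
    fk1 j k.+1 y <= S q'.+1 * fk1 j k.+1 y'.
  by move=> /ih; rewrite /mixing_ratio /mix mul1r.
have hb y := bdm_extend y (bdm_potential_fk1 j k).
rewrite -[fk1 j.+1 k x]/(mean (Q k.+1 (final x)) (fun e =>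
  Psi k.+1 (extend x e) * fk1 j k.+1 (extend x e))).
apply: le_trans (le_mean_mix h (hb x) (fun e => potential_fk1_ge0 _ _)) _.
rewrite /mixing_ratio -mulrA ler_wpM2l ?(le_trans ler01 (mix_ge1 q))//.
have hL := daniell_mean (kernel_at (Q k.+1) (final x')).
have [_ LZ _ _ _] := hL.
rewrite -[fk1 j.+1 k x']/(mean (kernel_at (Q k.+1) (final x')) (fun e =>
  Psi k.+1 (extend x' e) * fk1 j k.+1 (extend x' e))).
rewrite -LZ//; apply: (le_daniell hL) => // [|e]; first exact: bdmZ.
exact: potential_fk1_ratio.
Qed.

Lemma potential_fk1_bound j k x x' :
  Psi k.+1 x * fk1 j k.+1 x <= c * mixing_ratio 0 * (Psi k.+1 x' * fk1 j k.+1 x').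
Proof.
by rewrite mulrACA; apply: ler_pM;
  rewrite ?(ltW (Psi_gt0 _)) ?(ltW (fk1_gt0 _ _))//; apply: fk1_ratio; exact: agree0.
Qed.

Section contraction.
Variables (F : forall k, k.+1.-tuple E -> R) (n p : nat).
Hypothesis F_bdm : forall k, bdm (@F k).
Hypothesis F_le1 : forall x, `|@F n x| <= 1.
Hypothesis F_agree : forall x x', agree p x x' -> @F n x = F x'.

Let al q := (mixing_ratio q)^-1 ^+ 2.

(** The conditional laws of the next state overlap with mass at least [al q]. On the overlap the
    pasts come to agree on q + 1 states, elsewhere no agreement is kept: this is the recursion of
    [renewal]. *)
Lemma fk_ratio_contraction j k q (x x' : k.+1.-tuple E) :
  (k + j)%N = n -> agree q x x' ->
  fk_ratio F j x - fk_ratio F j x' <= renewal al p j q.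
Proof.
elim: j k q x x' => [|j ih] k q x x'.
  rewrite addn0 => kn; rewrite kn in x x' * => h.
  (* At time n the difference is at most 2, and it vanishes when the agreement covers the last p
     states. *)
  rewrite /fk_ratio /fk1 /= !divr1; have [qp|pq] := ltnP q p.
    have := F_le1 x; have := F_le1 x'; rewrite !ler_norml mulr1.
    by move=> /andP[h1 h2] /andP[h3 h4]; lra.
  rewrite (F_agree (x := x) (x' := x')) ?subrr ?mulr0// => i hi.
  by apply: h; apply: leq_trans hi; exact: leq_sub2l.
move=> kjn h; have kjn' : (k.+1 + j)%N = n by rewrite addSnnS.
(* [D y] is the unnormalized density, with respect to the kernel, of the next state conditioned on
   the observations up to time n. *)
pose D (y : k.+1.-tuple E) e := Psi k.+1 (extend y e) * fk1 j k.+1 (extend y e).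
pose f (y : k.+1.-tuple E) e := fk_ratio F j (extend y e).
have hD y : bdm (D y) := bdm_extend y (bdm_potential_fk1 j k).
have hf y : bdm (f y) by apply: bdm_extend; exact: bdm_fk_ratio.
have D_ge0 y e : 0 <= D y e := potential_fk1_ge0 _ _.
pose K (y : k.+1.-tuple E) := kernel_at (Q k.+1) (final y).
have fk1E y : fk1 j.+1 k y = mean (K y) (D y) by [].
have DK_gt0 y : 0 < mean (K y) (D y) by rewrite -fk1E fk1_gt0.
have hL y := daniell_reweight (daniell_mean (K y)) (hD y) (D_ge0 y) (DK_gt0 y).
have fk_ratioE y : fk_ratio F j.+1 y = mean (K y) (fun e => D y e * f y e) / mean (K y) (D y).
  rewrite /fk_ratio -fk1E /=; congr (_ / _).
  by congr mean; apply/funext => e; rewrite /D /f -mulrA -fkE.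
rewrite !fk_ratioE.
have ra0 : 0 < mixing_ratio q := lt_le_trans ltr01 (mixing_ratio_ge1 q).
rewrite /=; apply: (overlap_contraction (hL x) (hL x')) => //.
- by rewrite exprn_ge0// invr_ge0 ltW.
- move=> g hg g0.
  have hDg y : bdm (fun e => D y e * g e) by exact: bdmM.
  have Dg0 y e : 0 <= D y e * g e by exact: mulr_ge0.
  have le1 : mean (K x') (fun e => D x' e * g e) <=
      mixing_ratio q * mean (K x) (fun e => D x e * g e).
    apply: le_trans (le_mean_mix (agree_sym h) (hDg x') (Dg0 x')) _.
    rewrite /mixing_ratio -mulrA ler_wpM2l ?(le_trans ler01 (mix_ge1 q))//.
    have hK := daniell_mean (K x); have [_ LZ _ _ _] := hK.
    rewrite -LZ//; apply: (le_daniell hK) => // [|e]; first exact: bdmZ.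
    rewrite mulrA ler_wpM2r//; apply: potential_fk1_ratio; last exact: agree_sym.
    by move=> q' y y' /(fk1_ratio j); rewrite /mixing_ratio /mix mul1r.
  have le2 : mean (K x) (D x) <= mixing_ratio q * mean (K x') (D x').
    by rewrite -!fk1E; exact: fk1_ratio.
  apply: ratio_quotient_le => //; try exact: DK_gt0.
    - by apply: mean_ge0; exact: Dg0.
    - by apply: mean_ge0; exact: Dg0.
- by move=> e; apply: ih => //; exact: agree_extend.
- by move=> e e'; apply: ih => //; exact: agree0.
Qed.

End contraction.
End mixing.
End feynman_kac.

(** * Sampling error *)

Section iid.
Context {R : realType} {d : measure_display} {E : measurableType d}.
Variable n : nat.
Implicit Types (m : probability (n.-tuple E) R).

Lemma eq_iid_expectation (nu nu' : set (n.-tuple E) -> \bar R) N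
    (F : N.-tuple (n.-tuple E) -> \bar R) :
  (forall A, measurable A -> nu A = nu' A) ->
  iid_expectation nu F = iid_expectation nu' F.
Proof.
move=> e; elim: N F => [//|N ih] F /=.
rewrite (eq_integral_setfun _ e); congr (integral _ _ _); apply/funext => z; exact: ih.
Qed.

Lemma iid_expectation_ge0 m N (F : N.-tuple (n.-tuple E) -> \bar R) :
  (forall z, 0 <= F z)%E -> (0 <= iid_expectation m F)%E.
Proof.
elim: N F => [|N ih] F F0 /=; first exact: F0.
by apply: integral_ge0 => z _; apply: ih => s; exact: F0.
Qed.

Lemma le_iid_expectation m N (F F' : N.-tuple (n.-tuple E) -> \bar R) :
  (forall z, 0 <= F z)%E -> (forall z, F z <= F' z)%E ->
  (iid_expectation m F <= iid_expectation m F')%E.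
Proof.
elim: N F F' => [|N ih] F F' F0 FF' /=; first exact: FF'.
apply: le_integral_ge0 => z.
  by apply: iid_expectation_ge0 => s; exact: F0.
by apply: ih => s; [exact: F0 | exact: FF'].
Qed.

(** Second moment of a sum of independent centred terms, one draw at a time: [s] is the part already
    drawn, and the cross term 2 s G integrates to 0. *)
Lemma iid_expectation_sqr_le m N (G : n.-tuple E -> R) (K A B s : R) :
  bdm G -> mean m G = 0 -> (forall x, `|G x| <= K) -> 0 <= A -> 0 <= B ->
  (iid_expectation m (fun z : N.-tuple (n.-tuple E) =>
     (A + B * (s + \sum_(i < N) G (tnth z i)) ^+ 2)%:E) <=
   (A + B * (s ^+ 2 + N%:R * K ^+ 2))%:E)%E.
Proof.
move=> hG mG GK A0 B0; elim: N s => [|N ih] s /=.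
  by rewrite big_ord0 addr0 mul0r addr0.
have hc := bdm_cst (R := R) (T := n.-tuple E).
have hi : bdm (fun x => A + B * ((s + G x) ^+ 2 + N%:R * K ^+ 2)).
  have hsG : bdm (fun x => s + G x) := bdmD (hc s) hG.
  exact: bdmD (hc A) (bdmZ B (bdmD (bdmM hsG hsG) (hc _))).
apply: (@le_trans _ _ (\int[m]_x (A + B * ((s + G x) ^+ 2 + N%:R * K ^+ 2))%:E)%E).
  apply: le_integral_ge0 => z.
    apply: iid_expectation_ge0 => t.
    by rewrite lee_fin addr_ge0// mulr_ge0// sqr_ge0.
  apply: le_trans (ih (s + G z)); rewrite le_eqVlt; apply/orP; left; apply/eqP.
  congr (iid_expectation _ _); apply/funext => t.
  congr ((A + B * _ ^+ 2)%:E); rewrite big_ord_recl addrA; congr (_ + _ + _).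
  by apply: eq_bigr => i _; rewrite tnthS.
rewrite mean_EFin// lee_fin.
have hL := daniell_mean m; have [LD LZ _ _ _] := hL.
have hr : bdm (fun x => (A + B * (s ^+ 2 + N.+1%:R * K ^+ 2)) + (2 * B * s) * G x).
  exact: bdmD (hc _) (bdmZ _ hG).
apply: (@le_trans _ _ (mean m
    (fun x => (A + B * (s ^+ 2 + N.+1%:R * K ^+ 2)) + (2 * B * s) * G x))).
  apply: (le_daniell hL) => // x.
  have hGK : G x ^+ 2 <= K ^+ 2.
    by rewrite -[G x ^+ 2]real_normK ?num_real// ler_sqr ?nnegrE ?(le_trans _ (GK x)).
  rewrite -natr1 -subr_ge0 [X in 0 <= X](_ : _ = B * (K ^+ 2 - G x ^+ 2)); last by ring.
  by rewrite mulr_ge0// subr_ge0.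
by rewrite LD ?LZ//; [rewrite mG mulr0 addr0 mean_cst | exact: bdmZ].
Qed.

End iid.

Section sampling.
Context {R : realType} {d : measure_display} {E : measurableType d}.

(** The infimum of h serves as l; it bounds a sum of weights from below whatever the sample. *)
Lemma two_sided_bound (T : pointedType) (h : T -> R) (kappa : R) : 0 < kappa ->
  (forall x, 0 < h x) -> (forall x x', h x <= kappa * h x') ->
  exists2 l, 0 < l & forall x, l <= h x /\ h x <= kappa * l.
Proof.
move=> k0 h0 hk; pose A := range h.
have lbA : lbound A (h point / kappa).
  by move=> _ [x _ <-]; rewrite ler_pdivrMr// mulrC.
have A0 : A !=set0 by exists (h point), point.
have infA : has_inf A by split => //; exists (h point / kappa).
exists (inf A).
  by apply: lt_le_trans (lb_le_inf A0 lbA); rewrite divr_gt0.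
move=> x; split; first by apply: ge_inf; [case: infA | exists x].
rewrite -ler_pdivrMl//; apply: lb_le_inf => // _ [y _ <-].
by rewrite ler_pdivrMl.
Qed.

(* AM-GM avoids square roots of integrals: [|s| <= (s^2/th + th)/2]
   with [th] of the order of the standard deviation of s. *)
Lemma iid_weighted_average_le n M (nu : set (n.-tuple E) -> \bar R)
    (h g : n.-tuple E -> R) (kappa b B t : R) :
  is_law nu -> bdm h -> bdm g -> 0 < kappa -> (forall x, 0 < h x) ->
  (forall x x', h x <= kappa * h x') -> (forall x x', g x - g x' <= b) ->
  0 <= B ->
  (iid_expectation nu (fun z : M.+1.-tuple (n.-tuple E) =>
     (`|t - (\sum_(i < M.+1) h (tnth z i) * g (tnth z i)) /
            \sum_(i < M.+1) h (tnth z i)| + B)%:E) <=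
   (`|t - mean nu (fun x => h x * g x) / mean nu h| +
     (kappa * b / Num.sqrt M.+1%:R + B))%:E)%E.
Proof.
move=> [m hm] hh hg k0 h0 hk gb B0.
rewrite (eq_iid_expectation _ hm) !(eq_mean _ hm).
have [l l0 hl] := two_sided_bound k0 h0 hk.
have hhg : bdm (fun x => h x * g x) := bdmM hh hg.
have hL := daniell_mean m; have [LD LZ _ _ _] := hL.
have mh0 : 0 < mean m h by apply: (daniell_gt0 hL hh l0) => x; have [] := hl x.
set a := mean m (fun x => h x * g x) / mean m h.
have b0 : 0 <= b by have := gb point point; rewrite subrr.
(* Once centred at the exact average [a], the error is the sum of the [G] over the sum of the
   weights. *)
pose G x := h x * (g x - a).
have hc := bdm_cst (R := R) (T := n.-tuple E).
have hga : bdm (fun x => g x - a) := bdmB hg (hc a).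
have hG : bdm G := bdmM hh hga.
have mG : mean m G = 0.
  rewrite (_ : G = fun x => h x * g x - a * h x); last first.
    by apply/funext => x; rewrite /G mulrBr [a * _]mulrC.
  rewrite (daniellB hL) ?LZ//; last exact: bdmZ.
  by rewrite /a divfK ?subrr// gt_eqF.
(* [a] is a weighted average of the values of [g]. *)
have ga x : `|g x - a| <= b.
  have e c : a - c = mean m (fun y => h y * (g y - c)) / mean m h.
    rewrite (_ : (fun y => _) = fun y => h y * g y - c * h y); last first.
      by apply/funext => y; rewrite mulrBr [c * _]mulrC.
    rewrite (daniellB hL) ?LZ//; last exact: bdmZ.
    by rewrite mulrBl mulfK// gt_eqF.
  have h1 : 0 <= a - (g x - b).
    rewrite e divr_ge0 ?(ltW mh0)//; apply: mean_ge0 => y; rewrite mulr_ge0 ?(ltW (h0 y))//.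
    by have := gb x y; lra.
  have h2 : a - (g x + b) <= 0.
    rewrite e pmulr_lle0 ?invr_gt0// -oppr_ge0 -mulN1r -LZ; last first.
      exact: bdmM hh (bdmB hg (hc _)).
    apply: mean_ge0 => y; rewrite mulN1r -mulrN mulr_ge0 ?(ltW (h0 y))//.
    by have := gb y x; lra.
  by rewrite ler_norml; apply/andP; split; lra.
pose K := kappa * l * b.
have GK x : `|G x| <= K.
  rewrite /G normrM (ger0_norm (ltW (h0 x))); apply: ler_pM => //; first exact/ltW.
  by have [] := hl x.
have K0 : 0 <= K by rewrite !mulr_ge0 ?(ltW k0) ?(ltW l0).
pose N : R := M.+1%:R; have N0 : 0 < N by rewrite ltr0n.
have Nl0 : 0 < N * l by rewrite mulr_gt0.
(* A bound on the standard deviation of a sum of N centred terms of size at most [K]. The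
   coefficient [C] and the last term of [A] come from dividing (s^2 / th + th) / 2 by N l. *)
pose th := Num.sqrt N * K.
have th0 : 0 <= th by rewrite mulr_ge0 ?sqrtr_ge0.
pose A := `|t - a| + B + th / (2 * (N * l)).
pose C := (2 * th * (N * l))^-1.
have A0 : 0 <= A.
  apply: addr_ge0; first exact: addr_ge0.
  by apply: divr_ge0 => //; apply: mulr_ge0 => //; exact: ltW.
have C0 : 0 <= C.
  by rewrite invr_ge0; apply: mulr_ge0; [exact: mulr_ge0 | exact: ltW].
apply: (@le_trans _ _ (iid_expectation m (fun z : M.+1.-tuple (n.-tuple E) =>
    (A + C * (0 + \sum_(i < M.+1) G (tnth z i)) ^+ 2)%:E))).
  apply: le_iid_expectation => z; first by rewrite lee_fin addr_ge0.
  rewrite lee_fin add0r.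
  set s := \sum_(i < _) G _; set H := \sum_(i < _) h _.
  have H0 : N * l <= H.
    rewrite /N -(card_ord M.+1) mulr_natl -sumr_const.
    by apply: ler_sum => i _; have [] := hl (tnth z i).
  have H1 : 0 < H by exact: lt_le_trans H0.
  have -> : (\sum_(i < M.+1) h (tnth z i) * g (tnth z i)) / H = a + s / H.
    rewrite /s /G; under [in RHS]eq_bigr do rewrite mulrBr.
    rewrite sumrB -mulr_suml -/H mulrBl mulrAC divff ?gt_eqF// mul1r; ring.
  have -> : t - (a + s / H) = (t - a) - s / H by ring.
  apply: le_trans (lerD (ler_normB _ _) (lexx B)) _.
  have : `|s / H| <= `|s| / (N * l).
    by rewrite normrM normfV (gtr0_norm H1) ler_wpM2l// lef_pV2.
  have arith (x y w u v r : R) : w <= v + u -> y <= w -> x + y + r <= x + r + u + v.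
    by lra.
  suff : `|s| / (N * l) <= C * s ^+ 2 + th / (2 * (N * l)).
    by move=> /arith h1 /h1; exact.
  (* If [th] is 0 then [C] is the inverse of 0, that is 0; the bound survives since [K = 0] forces
     [s = 0]. *)
  have [th00|thn0] := eqVneq th 0.
    have K00 : K = 0.
      move: th00 => /eqP; rewrite mulf_eq0 sqrtr_eq0 leNgt N0/= => /eqP //.
    have -> : s = 0.
      apply: big1 => i _; apply/eqP; rewrite -normr_eq0 eq_le normr_ge0 andbT.
      by rewrite -K00.
    by rewrite normr0 mul0r th00 expr0n/= mulr0 mul0r addr0.
  have th1 : 0 < th by rewrite lt_def thn0.
  rewrite ler_pdivrMr// -subr_ge0 -(real_normK (num_real s)).
  rewrite [X in 0 <= X](_ : _ = (`|s| - th) ^+ 2 / (2 * th)).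
    by rewrite divr_ge0 ?sqr_ge0// mulr_ge0.
  rewrite /C; field.
  by rewrite thn0 (gt_eqF l0) nat1r pnatr_eq0.
apply: le_trans (iid_expectation_sqr_le _ _ hG mG GK A0 C0) _.
rewrite lee_fin /A.
suff -> : `|t - a| + B + th / (2 * (N * l)) + C * (0 ^+ 2 + M.+1%:R * K ^+ 2) =
  `|t - a| + (kappa * b / Num.sqrt M.+1%:R + B) by [].
rewrite -/N /C /th expr0n/= add0r.
have q0 : 0 < Num.sqrt N by rewrite sqrtr_gt0.
have -> : N * l = Num.sqrt N ^+ 2 * l by rewrite sqr_sqrtr// ltW.
have -> : N * K ^+ 2 = Num.sqrt N ^+ 2 * K ^+ 2 by rewrite sqr_sqrtr// ltW.
have [K00|Kn0] := eqVneq K 0.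
  have b00 : b = 0.
    by move/eqP: K00; rewrite /K mulf_eq0 mulf_eq0 (gt_eqF k0) (gt_eqF l0)/= => /eqP.
  by rewrite K00 b00 expr0n /= !(mulr0, mul0r, addr0, add0r).
have -> : kappa * b / Num.sqrt N = K / (Num.sqrt N * l).
  by rewrite /K; field; rewrite (gt_eqF q0) (gt_eqF l0).
field.
by rewrite (gt_eqF l0) (gt_eqF q0) Kn0.
Qed.

End sampling.

(** * Propagation of the error along the particle system *)

Section particles.
Context {R : realType} {d : measure_display} {E : measurableType d}.
Variables (zeta : probability E R) (Q : nat -> R.-pker E ~> E).
Variable Psi : forall n, n.+1.-tuple E -> R.
Arguments Psi : clear implicits.
Hypothesis Psi_bdm : forall n, bdm (Psi n.+1).
Hypothesis Psi_lb : forall n, exists2 l, 0 < l & forall x, l <= Psi n.+1 x.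

Let Psi_pos n x : 0 < Psi n.+1 x := Psi_gt0 Psi_lb x.

(** Expectation of F_{k+j} after j steps of the exact flow started from mu at time k. *)
Definition fk_mean (F : forall k, k.+1.-tuple E -> R) j k
    (mu : set (k.+1.-tuple E) -> \bar R) : R :=
  mean mu (@fk R d E Q Psi F j k) / mean mu (@fk1 R d E Q Psi j k).

Lemma is_law_initial : is_law (initial zeta).
Proof.
have hz : is_law zeta by exists zeta.
apply: (proj1 (is_law_pushforward hz _)).
apply/measurable_fun_tnthP => i; rewrite (_ : _ \o _ = id); first exact: measurable_id.
by apply/funext => e /=; rewrite (ord1 i) (tnth_nth e).
Qed.

Lemma is_law_step k (mu : set (k.+1.-tuple E) -> \bar R) :
  is_law mu -> is_law (R_op Q Psi mu).
Proof.
move=> hmu; have [l l0 hl] := Psi_lb k.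
by have [] := is_law_R_op Q Psi_bdm Psi_pos hmu l0 hl.
Qed.

Lemma is_law_R_iter k : is_law (@R_iter R d E zeta Q Psi k).
Proof. by elim: k => [|k ih]; [exact: is_law_initial | exact: is_law_step]. Qed.

Section functional.
Variable F : forall k, k.+1.-tuple E -> R.
Hypothesis F_bdm : forall k, bdm (@F k).

Lemma fk_mean_R_op j k (mu : set (k.+1.-tuple E) -> \bar R) : is_law mu ->
  fk_mean F j (R_op Q Psi mu) = fk_mean F j.+1 mu.
Proof.
move=> hmu; have [l l0 hl] := Psi_lb k.
have [_ hR] := is_law_R_op Q Psi_bdm Psi_pos hmu l0 hl.
have g0 : 0 < mean mu (kstep Q (Psi k.+1)).
  exact: (daniell_gt0 (daniell_kstep Q hmu) (Psi_bdm k) l0 hl).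
rewrite /fk_mean hR; last exact: bdm_fk.
rewrite hR; last exact: bdm_fk1.
by rewrite -mulf_div divff ?mulr1 ?invr_eq0 ?gt_eqF.
Qed.

Lemma fk_mean_R_iter k j :
  fk_mean F j (@R_iter R d E zeta Q Psi k) = fk_mean F (k + j) (initial zeta).
Proof.
elim: k j => [//|k ih] j /=.
by rewrite fk_mean_R_op ?ih ?addnS//; exact: is_law_R_iter.
Qed.

(** With [fk_mean_boltzmann], this writes the exact step and the particle step, both propagated, as
    averages of one function with the same weights, under a law and under a sample from it. *)
Lemma fk_mean_Q_bar j k (mu : set (k.+1.-tuple E) -> \bar R) : is_law mu ->
  fk_mean F j.+1 mu =
  mean (Q_bar Q mu) (fun x => (Psi k.+1 x * @fk1 R d E Q Psi j k.+1 x) *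
                              fk_ratio Q Psi F j x) /
  mean (Q_bar Q mu) (fun x => Psi k.+1 x * @fk1 R d E Q Psi j k.+1 x).
Proof.
move=> hmu; have [_ hQ] := is_law_Q_bar Q hmu.
have hh := bdm_potential_fk1 Q Psi_bdm j k.
rewrite !hQ//; last by apply: bdmM => //; exact: bdm_fk_ratio.
rewrite /fk_mean /=; congr (mean mu (kstep Q _) / _); apply/funext => x.
by rewrite (fkE Q Psi_bdm Psi_lb) mulrA.
Qed.

Lemma fk_mean_boltzmann j k M (z : M.+1.-tuple (k.+2.-tuple E)) :
  fk_mean F j (boltzmann (Psi k.+1) (empirical z)) =
  (\sum_(i < M.+1) (Psi k.+1 (tnth z i) * @fk1 R d E Q Psi j k.+1 (tnth z i)) *
     fk_ratio Q Psi F j (tnth z i)) /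
  \sum_(i < M.+1) (Psi k.+1 (tnth z i) * @fk1 R d E Q Psi j k.+1 (tnth z i)).
Proof.
have [_ hB] := is_law_boltzmann_empirical z (Psi_bdm k) (@Psi_pos k).
have s0 : 0 < \sum_(i < M.+1) Psi k.+1 (tnth z i).
  by rewrite big_ord_recl; apply: ltr_wpDr => //; apply: sumr_ge0 => i _; exact/ltW.
rewrite /fk_mean hB; last exact: bdm_fk.
rewrite hB; last exact: bdm_fk1.
rewrite -mulf_div divff ?mulr1 ?invr_eq0 ?gt_eqF//; congr (_ / _).
by apply: eq_bigr => i _; rewrite (fkE Q Psi_bdm Psi_lb) mulrA.
Qed.

End functional.

(** Every measure reached by the particle system is a law, so the integrands are compared on laws
    alone. *)
Lemma le_particle_expectation M k (G G' : (set (k.+1.-tuple E) -> \bar R) -> \bar R) :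
  (forall mu, is_law mu -> (0 <= G mu)%E /\ (G mu <= G' mu)%E) ->
  (particle_expectation zeta Q Psi M.+1 G <=
   particle_expectation zeta Q Psi M.+1 G')%E.
Proof.
elim: k G G' => [|k ih] G G' h; first by have [] := h _ is_law_initial.
pose step H (mu : set (k.+1.-tuple E) -> \bar R) : \bar R :=
  iid_expectation (Q_bar Q mu) (fun z : M.+1.-tuple (k.+2.-tuple E) =>
    H (boltzmann (Psi k.+1) (empirical z))).
apply: (ih (step G) (step G')) => mu hmu; have [[m hm] _] := is_law_Q_bar Q hmu.
rewrite /step !(eq_iid_expectation _ hm).
have hz (z : M.+1.-tuple (k.+2.-tuple E)) :
    is_law (boltzmann (Psi k.+1) (empirical z)).
  exact: (proj1 (is_law_boltzmann_empirical z (Psi_bdm k) (@Psi_pos k))).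
split; first by apply: iid_expectation_ge0 => z; have [] := h _ (hz z).
by apply: le_iid_expectation => z; have [] := h _ (hz z).
Qed.

Section error.
Variables (eps c : R) (r S : nat -> R).
Hypothesis eps_gt0 : 0 < eps.
Hypothesis eps_le1 : eps <= 1.
Hypothesis Q_mix : forall n x x' (f : E -> R), bdm f -> (forall e, 0 <= f e) ->
  mean (Q n.+1 x) f <= eps ^- 2 * mean (Q n.+1 x') f.
Hypothesis c_gt0 : 0 < c.
Hypothesis Psi_c : forall n x x', Psi n.+1 x <= c * Psi n.+1 x'.
Hypothesis Psi_agree : forall n q (x x' : n.+2.-tuple E), agree q x x' ->
  Psi n.+1 x <= r q * Psi n.+1 x'.
Hypothesis S_ge1 : forall q, 1 <= S q.
Hypothesis rS : forall q, r q.+1 * S q.+1 <= S q.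

Let al q := (mixing_ratio eps S q)^-1 ^+ 2.
Let kappa := c * mixing_ratio eps S 0.

Lemma al_bounds q : 0 <= al q <= 1.
Proof.
have r1 := mixing_ratio_ge1 eps_gt0 eps_le1 S_ge1 q.
have r0 : 0 < mixing_ratio eps S q := lt_le_trans ltr01 r1.
by rewrite /al exprn_ge0 ?invr_ge0 ?(ltW r0)//= exprn_ile1 ?invr_ge0 ?(ltW r0)// invf_le1.
Qed.

(** The telescopic sum, unrolled backwards: averaging over the sample of the last step replaces that
    step by the exact one, at a price set by the oscillation j steps before time n. [B] gathers the
    prices already paid. *)
Lemma particle_expectation_le (F : forall k, k.+1.-tuple E -> R) n p M k j B :
  (forall k, bdm (@F k)) -> (forall x, `|@F n x| <= 1) ->
  (forall x x', agree p x x' -> @F n x = F n x') -> (k + j)%N = n -> 0 <= B ->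
  (particle_expectation zeta Q Psi M.+1 (fun mu : set (k.+1.-tuple E) -> \bar R =>
     (`|fk_mean F n (initial zeta) - fk_mean F j mu| + B)%:E) <=
   (\sum_(j <= i < n) kappa * renewal al p i 0 / Num.sqrt M.+1%:R + B)%:E)%E.
Proof.
move=> F_bdm F_le1 F_agree; elim: k j B => [|k ih] j B.
  by rewrite add0n => -> _ /=; rewrite subrr normr0 add0r big_geq// add0r.
move=> kjn B0; have jn : (j < n)%N by rewrite -kjn addSn ltnS leq_addl.
have kappa0 : 0 < kappa.
  by rewrite mulr_gt0//; exact: lt_le_trans ltr01 (mixing_ratio_ge1 _ _ _ _).
have e0 : 0 <= kappa * renewal al p j 0 / Num.sqrt M.+1%:R.
  rewrite divr_ge0 ?sqrtr_ge0// mulr_ge0 ?(ltW kappa0)//.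
  by apply: renewal_ge0; exact: al_bounds.
rewrite big_ltn// [X in (_ <= (X + _)%:E)%E]addrC -addrA.
apply: le_trans (ih j.+1 _ _ _); last first.
- exact: addr_ge0.
- by rewrite -addSnnS.
pose e (mu : set (k.+1.-tuple E) -> \bar R) : \bar R :=
  iid_expectation (Q_bar Q mu) (fun z : M.+1.-tuple (k.+2.-tuple E) =>
    (`|fk_mean F n (initial zeta) -
       fk_mean F j (boltzmann (Psi k.+1) (empirical z))| + B)%:E).
rewrite -[leLHS]/(particle_expectation zeta Q Psi M.+1 e).
apply: le_particle_expectation => mu hmu; rewrite /e.
have [hQm hQ] := is_law_Q_bar Q hmu.
under [X in iid_expectation _ X]eq_fun do rewrite fk_mean_boltzmann//.
split.
  have [m hm] := hQm; rewrite (eq_iid_expectation _ hm).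
  by apply: iid_expectation_ge0 => z; rewrite lee_fin addr_ge0.
rewrite (fk_mean_Q_bar F_bdm j hmu).
apply: (@iid_weighted_average_le _ _ _ _ _ _
  (fun x => Psi k.+1 x * @fk1 R d E Q Psi j k.+1 x) (@fk_ratio R d E Q Psi F j k.+1)
  kappa (renewal al p j 0) B) => //.
- exact: bdm_potential_fk1.
- exact: bdm_fk_ratio.
- by move=> x; rewrite mulr_gt0// ?Psi_pos// (fk1_gt0 Q Psi_bdm Psi_lb).
- by move=> x x'; exact: (potential_fk1_bound Psi_bdm Psi_lb eps_gt0 eps_le1 Q_mix
     Psi_c Psi_agree S_ge1 rS).
- move=> x x'; apply: (fk_ratio_contraction Psi_bdm Psi_lb eps_gt0 eps_le1 Q_mix
     Psi_agree S_ge1 rS F_bdm F_le1 F_agree).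
    exact: kjn.
  exact: agree0.
Qed.

Lemma particle_error_le (T : nat -> R) n p M :
  (forall q, 0 < T q) -> (forall q, T q <= 1) ->
  (forall q, T q = al q * T q.+1) ->
  (particle_error zeta Q Psi M.+1 p n <=
   (kappa * (2 * p%:R / T 0%N) / Num.sqrt M.+1%:R)%:E)%E.
Proof.
move=> T_gt0 T_le1 TS; apply: ge_ereal_sup => _ [f [mf f1] <-].
have f_le1 x : `|f x| <= 1.
  by rewrite -lee_fin -f1; apply: ereal_sup_ubound; exists x.
(* A family indexed by all path lengths, so as to avoid casts along
   k + j = n; only its n-th member matters. *)
pose F k (x : k.+1.-tuple E) : R :=
  f [tuple tnth x (inord (n.+1 - p + i)) | i < minn n.+1 p].
have F_bdm k : bdm (@F k).
  split; last by exists 1 => x; exact: f_le1.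
  apply: (measurableT_comp (f := f)) => //.
  exact: (@measurable_select _ E _ k.+1 (fun i : 'I_(minn n.+1 p) => inord (n.+1 - p + i))).
have F_agree (x x' : n.+1.-tuple E) : agree p x x' -> F n x = F n x'.
  by move=> h; rewrite -[F n x]/(f (window p x)) (agree_window h).
have pairingE (mu : set (n.+1.-tuple E) -> \bar R) : is_law mu ->
    pairing (@H_op R d E p n mu) f = fk_mean F 0 mu.
  move=> hmu; have mw : measurable_fun setT (@window E p n).
    exact: (@measurable_select _ E _ n.+1 (fun i : 'I_(minn n.+1 p) => inord (n.+1 - p + i))).
  have [_ hw] := is_law_pushforward hmu mw.
  rewrite /fk_mean -[mean mu (@fk1 R d E Q Psi 0 n)]/(mean mu (fun=> 1)).
  rewrite (daniell1 (daniell_is_law hmu)) divr1 -[LHS]/(mean (pushforward mu _) f).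
  by rewrite hw//; split => //; exists 1.
have tE : pairing (@H_op R d E p n (@R_iter R d E zeta Q Psi n)) f = fk_mean F n (initial zeta).
  rewrite pairingE; last exact: is_law_R_iter.
  by rewrite (fk_mean_R_iter F_bdm n 0) addn0.
rewrite tE.
pose e (mu : set (n.+1.-tuple E) -> \bar R) :=
  ((`|fk_mean F n (initial zeta) - fk_mean F 0 mu| + 0)%:E)%E.
apply: (@le_trans _ _ (particle_expectation zeta Q Psi M.+1 e)).
  apply: le_particle_expectation => mu hmu.
  by rewrite /e pairingE// addr0 lee_fin.
have F_le1 x : `|@F n x| <= 1 by exact: f_le1.
apply: le_trans (particle_expectation_le _ F_bdm F_le1 F_agree (addn0 n) (lexx 0)) _.
rewrite lee_fin addr0 big_mkord -mulr_suml -mulr_sumr.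
apply: ler_wpM2r; first by rewrite invr_ge0 sqrtr_ge0.
apply: ler_wpM2l.
  by rewrite mulr_ge0 ?(ltW c_gt0)// (le_trans ler01)//; exact: mixing_ratio_ge1.
exact: (sum_renewal_le _ T_gt0 T_le1 al_bounds TS).
Qed.

End error.

End particles.

(** * Explicit bound for geometrically decaying memory *)

Section particles.
Context {R : realType} {d : measure_display} {E : measurableType d}.
Variables (zeta : probability E R) (Q : nat -> R.-pker E ~> E).
Variable Psi : forall n, n.+1.-tuple E -> R.
Arguments Psi : clear implicits.
Hypothesis Psi_bdm : forall n, bdm (Psi n.+1).
Hypothesis Psi_lb : forall n, exists2 l, 0 < l & forall x, l <= Psi n.+1 x.

(* [S_q] and [T_q] below are the products over i > q of the oscillation
   factors exp(G tau^i) and, respectively, over i >= q of the coupling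
   probabilities S_i^-2 (eps^4 S_0^-2 if i = 0). *)
Lemma particle_error_exp_le (eps c G tau : R) n p M :
  0 < eps -> eps <= 1 ->
  (forall n x x' (f : E -> R), bdm f -> (forall e, 0 <= f e) ->
     mean (Q n.+1 x) f <= eps ^- 2 * mean (Q n.+1 x') f) ->
  0 < c -> (forall n x x', Psi n.+1 x <= c * Psi n.+1 x') ->
  0 <= G -> 0 < tau < 1 ->
  (forall n q (x x' : n.+2.-tuple E), agree q x x' ->
     Psi n.+1 x <= expR (G * tau ^+ q) * Psi n.+1 x') ->
  (particle_error zeta Q Psi M.+1 p n <=
   (2 * c / eps ^+ 6 * expR (G * (tau / (1 - tau) + 2 * tau / (1 - tau) ^+ 2)) *
    p%:R / Num.sqrt M.+1%:R)%:E)%E.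
Proof.
move=> eps0 eps1 Q_mix c0 Psi_c G0 /andP[tau0 tau1] Psi_agree.
have t0 : 0 < 1 - tau by rewrite subr_gt0.
have tn0 : 1 - tau != 0 by rewrite gt_eqF.
have en0 : eps != 0 by rewrite gt_eqF.
(* Geometric sums: the exponent of [S q] adds G tau^i over i > q, and that of [T q] is minus twice
   the sum of the exponents of the [S i] over i >= q. *)
pose S q := expR (G * tau ^+ q.+1 / (1 - tau)).
pose T q := (if q == 0%N then eps ^+ 4 else 1) *
            expR (- (2 * G * tau ^+ q.+1 / (1 - tau) ^+ 2)).
have S1 q : 1 <= S q.
  by rewrite -expR0 ler_expR divr_ge0 ?mulr_ge0 ?exprn_ge0 ?(ltW tau0) ?(ltW t0).
have rS q : expR (G * tau ^+ q.+1) * S q.+1 <= S q.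
  by rewrite -expRD ler_expR le_eqVlt; apply/orP; left; apply/eqP; rewrite !exprS; field.
have T_gt0 q : 0 < T q.
  by rewrite mulr_gt0 ?expR_gt0//; case: eqP => // _; rewrite exprn_gt0.
have T_le1 q : T q <= 1.
  apply: mulr_ile1.
  - by case: eqP => // _; rewrite exprn_ge0// ltW.
  - exact: expR_ge0.
  - by case: eqP => // _; rewrite exprn_ile1// ltW.
  rewrite -[leRHS]expR0 ler_expR oppr_le0; apply: divr_ge0.
    by apply: mulr_ge0; [exact: mulr_ge0 | exact/exprn_ge0/ltW].
  by rewrite exprn_ge0 ?(ltW t0).
have TS q : T q = (mixing_ratio eps S q)^-1 ^+ 2 * T q.+1.
  have SE : S q ^- 2 = expR (- (2 * G * tau ^+ q.+1 / (1 - tau))).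
    by rewrite /S -expRM_natl -expRN; congr expR; ring.
  have mE : (mix eps q)^-1 ^+ 2 = if q == 0%N then eps ^+ 4 else 1.
    by rewrite /mix; case: eqP => // _; [field | rewrite invr1 expr1n].
  rewrite {1}/T -mE /mixing_ratio [(mix eps q * S q)^-1]invfM exprMn [(S q)^-1 ^+ 2]exprVn SE.
  rewrite /T /= mul1r -[RHS]mulrA -expRD; congr (_ * expR _).
  by rewrite !exprS; field.
apply: le_trans (particle_error_le zeta Psi_bdm Psi_lb eps0 eps1 Q_mix c0
  Psi_c Psi_agree S1 rS n p M T_gt0 T_le1 TS) _.
rewrite lee_fin le_eqVlt; apply/orP; left; apply/eqP; congr (_ / _).
(* The eps^-2 of [mixing_ratio] at 0 and the eps^-4 of 1 / [T 0] make up eps^-6. *)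
rewrite /T /S /mixing_ratio /mix /= expr1 mulrDr expRD expRN.
have -> : G * (tau / (1 - tau)) = G * tau / (1 - tau) by ring.
have -> : G * (2 * tau / (1 - tau) ^+ 2) = 2 * G * tau / (1 - tau) ^+ 2 by ring.
set A := expR _; set B := expR _.
field; rewrite en0 /=; exact: lt0r_neq0 (expR_gt0 _).
Qed.

End particles.

(** * The constants of the bound *)

Section rate.
Context {R : realType}.
Variables (c eps phi tau G X : R).
Hypothesis tau01 : 0 < tau < 1.
Hypothesis c_ge1 : 1 <= c.
Hypothesis eps_gt0 : 0 < eps.
Hypothesis phi_gt0 : 0 < phi.

Let c_gt0 : 0 < c := lt_le_trans ltr01 c_ge1.
Let L := ln tau.
Let k := 4 * c / (3 * phi).
(** The number whose ceiling enters [bound_p]; it tends to infinity since ln tau < 0. *)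
Let v N : R := (ln k - ln (Num.sqrt N%:R)) / L.

Let L_lt0 : L < 0. Proof. by have /andP[t0 t1] := tau01; rewrite ln_lt0// t0. Qed.

Let k_gt0 : 0 < k. Proof. by rewrite divr_gt0 ?mulr_gt0. Qed.

Let sqrt_gt0 N : (0 < N)%N -> 0 < Num.sqrt N%:R :> R.
Proof. by move=> N0; rewrite sqrtr_gt0 ltr0n. Qed.

Lemma bound_p_le N : (0 < N)%N -> 0 <= v N -> (bound_p c phi tau N)%:R <= v N + 1.
Proof.
move=> N0 v0; rewrite /bound_p.
have -> : ln (4 * c / (3 * phi * Num.sqrt N%:R)) / ln tau = v N.
  rewrite /v -ln_div ?posrE ?sqrt_gt0//; congr (ln _ / _).
  by rewrite /k invfM mulrA.
have c0 : 0 <= Num.ceil (v N) by rewrite ceil_ge0 (lt_le_trans _ v0)// ltrN10.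
rewrite natr_absz ger0_norm// ltW// -ltrBlDr.
have := ceilB1_lt (v N); rewrite intrB; exact.
Qed.

(* With p* = v + 1 the bound is 32 p* c^(3 p* - 5) / (eps^6 sqrt N). *)
Lemma boundE N : (0 < N)%N ->
  bound_C c eps phi tau * (ln N%:R + bound_D c phi tau) *
    (1 / Num.sqrt N%:R) `^ (1 + 3 * ln c / ln tau) =
  32 / (eps ^+ 6 * c ^+ 2) * (v N + 1) * expR (3 * ln c * v N) / Num.sqrt N%:R.
Proof.
move=> N0; have s0 := sqrt_gt0 N0; set q := Num.sqrt N%:R in s0 *.
have lnN : ln N%:R = 2 * ln q.
  rewrite -[N%:R](@sqr_sqrtr R) ?ler0n// lnXn// mulr_natl //.
have lnD : ln (3 * phi / (4 * c * tau)) = - ln k - L.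
  have /andP[t0 _] := tau01.
  rewrite -lnV ?posrE// -ln_div ?posrE ?invr_gt0//; congr ln.
  by rewrite /k invf_div invfM mulrA.
have qE : q^-1 = expR (- ln q) by rewrite expRN lnK.
have n1 : 1 / q != 0 by rewrite mul1r invr_eq0 gt_eqF.
have n2 : k != 0 by rewrite gt_eqF.
have L0 : L != 0 by rewrite lt_eqF.
rewrite /bound_C /bound_D lnN lnD -/k -/L /powR (negbTE n1) (negbTE n2).
have -> : ln (1 / q) = - ln q by rewrite mul1r lnV.
have -> : 3 * ln c * v N = 3 * ln c / L * ln k - 3 * ln c / L * ln q.
  by rewrite /v -/q; field.
have -> : (1 + 3 * ln c / L) * - ln q = - (3 * ln c / L * ln q) + - ln q by ring.
rewrite !expRD -qE /v -/q.
set e1 := expR (3 * ln c / L * ln k); set e2 := expR (- _).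
by field; rewrite L0 !gt_eqF.
Qed.

Lemma eventually_v_ge V : exists N0 : nat, forall N, (N0 <= N)%N ->
  (0 < N)%N /\ V <= v N.
Proof.
(* The solution N of v N = V. *)
pose x := expR (2 * (ln k - L * V)).
exists (Num.bound x) => N hN.
have xN : x < N%:R.
  by apply: lt_le_trans (archi_boundP (expR_ge0 _)) _; rewrite ler_nat.
have N0 : (0 < N)%N by rewrite -(ltr0n R); exact: lt_trans (expR_gt0 _) xN.
split => //; have q0 := sqrt_gt0 N0.
have : ln x <= ln N%:R by rewrite ler_ln ?posrE ?expR_gt0 ?ltr0n// ltW.
rewrite /x expRK -[N%:R](@sqr_sqrtr R) ?ler0n// lnXn// -mulr_natl => h.
rewrite /v ler_ndivlMr//; move: h; rewrite mulrC; lra.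
Qed.

Lemma eventually_bound : (c = 1 -> G = 0) -> exists N0 : nat, forall N, (N0 <= N)%N ->
  (0 < N)%N /\
  2 * c / eps ^+ 6 * expR (G * X) * (bound_p c phi tau N)%:R / Num.sqrt N%:R <=
  bound_C c eps phi tau * (ln N%:R + bound_D c phi tau) *
    (1 / Num.sqrt N%:R) `^ (1 + 3 * ln c / ln tau).
Proof.
(* If c > 1, then c^(3V) is at least c^3 exp(G X). If c = 1, the division by ln c = 0 yields
   [V = 0], and G = 0 leaves nothing to absorb. *)
move=> G1; pose V := Num.max 0 ((3 * ln c + G * X) / (3 * ln c)).
have [N0 hN0] := eventually_v_ge V; exists N0 => N /hN0[N_gt0 hV].
have v0 : 0 <= v N by apply: le_trans hV; rewrite le_max lexx.
split => //; rewrite boundE// ler_pM2r ?invr_gt0 ?sqrt_gt0//.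
have hp := bound_p_le N_gt0 v0.
have e0 : 0 <= expR (3 * ln c * v N) := expR_ge0 _.
(* What remains to compare once p is bounded by v + 1 and the factor 2 / (eps^6 c^2) is taken
   out. *)
have key : c ^+ 3 * expR (G * X) <= 16 * expR (3 * ln c * v N).
  have [c1|cn1] := eqVneq c 1.
    by rewrite (G1 c1) c1 ln1 mulr0 !mul0r expR0 expr1n !mulr1 ler1n.
  have c1 : 1 < c by rewrite lt_def cn1.
  have lc0 : 0 < 3 * ln c by rewrite mulr_gt0// ln_gt0.
  have -> : c ^+ 3 = expR (3 * ln c) by rewrite expRM_natl lnK.
  rewrite -expRD (@le_trans _ _ (expR (3 * ln c * v N)))//; last first.
    by rewrite -[leLHS]mul1r ler_wpM2r// ler1n.
  rewrite ler_expR -ler_pdivrMl// mulrC; apply: le_trans hV.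
  by rewrite le_max lexx orbT.
have -> : 2 * c / eps ^+ 6 * expR (G * X) * (bound_p c phi tau N)%:R =
    2 / (eps ^+ 6 * c ^+ 2) * ((c ^+ 3 * expR (G * X)) * (bound_p c phi tau N)%:R).
  by field; rewrite !gt_eqF.
have -> : 32 / (eps ^+ 6 * c ^+ 2) * (v N + 1) * expR (3 * ln c * v N) =
    2 / (eps ^+ 6 * c ^+ 2) * ((16 * expR (3 * ln c * v N)) * (v N + 1)).
  by field; rewrite !gt_eqF.
rewrite ler_pM2l ?divr_gt0 ?mulr_gt0 ?exprn_gt0//.
by apply: ler_pM => //; rewrite mulr_ge0 ?exprn_ge0 ?expR_ge0// ltW.
Qed.

(** Below [p0] only the crude ratio c is at hand, and ln c / tau^p0 makes the exponent at least ln
    c. From [p0] on, (1 + u)^2 <= exp(2u) with u = phi tau^q. For c = 1 the crude ratio suffices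
    throughout. *)
Lemma memory_constant (p0 : nat) : exists G' : R, [/\ 0 <= G', c = 1 -> G' = 0 &
  forall q, c <= expR (G' * tau ^+ q) \/
    (p0 <= q)%N /\ (1 + phi * tau ^+ q) ^+ 2 <= expR (G' * tau ^+ q)].
Proof.
have /andP[t0 t1] := tau01.
have [c1|cn1] := eqVneq c 1.
  by exists 0; split => // q; left; rewrite mul0r expR0 c1.
have c1 : 1 < c by rewrite lt_def cn1.
have l0 : 0 < ln c by rewrite ln_gt0.
have tq q : 0 < tau ^+ q by rewrite exprn_gt0.
exists (2 * phi + ln c / tau ^+ p0); split.
- by rewrite addr_ge0 ?divr_ge0 ?(ltW l0) ?(ltW (tq _))// mulr_ge0 ?(ltW phi_gt0).
- by move=> ce; rewrite ce ltxx in c1.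
move=> q; have [qp|pq] := ltnP q p0; [left | right; split => //].
  rewrite -{1}(lnK (c_gt0 : c \is Num.pos)) ler_expR mulrDl.
  apply: (@le_trans _ _ (ln c / tau ^+ p0 * tau ^+ q)); last first.
    by rewrite lerDr mulr_ge0 ?(ltW (tq _))// mulr_ge0 ?(ltW phi_gt0).
  rewrite -mulrA ler_peMr ?(ltW l0)// mulrC ler_pdivlMr// mul1r.
  by rewrite ler_wiXn2l ?(ltW t0) ?(ltW t1)// ltnW.
apply: (@le_trans _ _ (expR (phi * tau ^+ q) ^+ 2)).
  rewrite ler_sqr ?nnegrE ?expR_ge0 ?expR_ge1Dx//.
  by rewrite addr_ge0// mulr_ge0 ?(ltW phi_gt0) ?(ltW (tq _)).
rewrite -expRM_natl ler_expR; set u := ln c / _.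
rewrite (_ : (2 * phi + u) * tau ^+ q = 2 * (phi * tau ^+ q) + u * tau ^+ q); last by ring.
by rewrite lerDl mulr_ge0 ?(ltW (tq _))// divr_ge0 ?(ltW l0) ?(ltW (tq _)).
Qed.

End rate.

(** * Consequences of the hypotheses *)

Section hypotheses.
Context {R : realType} {d dY : measure_display} {E : measurableType d}
  {Y : measurableType dY}.

(** Both kernels are compared with the reference measure, at the price of 1 / [eps] each. *)
Lemma mean_kernel_mix (Q : nat -> R.-pker E ~> E) (epsn : nat -> R) (eps : R) :
  hypothesis1 Q epsn -> 0 < eps -> (forall n, (0 < n)%N -> eps <= epsn n) ->
  forall n x x' (f : E -> R), bdm f -> (forall e, 0 <= f e) ->
    mean (Q n.+1 x) f <= eps ^- 2 * mean (Q n.+1 x') f.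
Proof.
move=> h1 eps0 hn n x x' f hf f0.
have [/andP[en0 _] [xi hxi]] := h1 n.+1 isT.
have een := hn n.+1 isT.
have [mf _] := hf; have mef : measurable_fun setT (EFin \o f) by exact/measurable_EFinP.
have r0 : 0 <= eps ^- 2 by rewrite invr_ge0 exprn_ge0// ltW.
rewrite -lee_fin EFinM -!(mean_EFin (kernel_at (Q n.+1) _)) //.
rewrite -(@ge0_integral_mscale _ _ _ _ setT measurableT (NngNum r0) (EFin \o f))//; last first.
  by move=> e _; rewrite lee_fin.
apply: ge0_le_measure_integral => // A mA.
have [_ hA] := hxi x A mA; have [hA' _] := hxi x' A mA.
rewrite /mscale /=; apply: le_trans hA _.
have xiA0 : (0 <= xi A)%E by [].
apply: (@le_trans _ _ ((eps ^-2)%:E * ((epsn n.+1)%:E * xi A))%E); last first.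
  by apply: lee_pmul => //; rewrite ?lee_fin// mule_ge0// lee_fin ltW.
rewrite muleA -EFinM lee_wpmul2r// lee_fin ler_pdivlMl ?exprn_gt0//.
by rewrite ler_pdivrMr// expr2; apply: ler_pM => //; exact: ltW.
Qed.

Variables (Psi : forall n, n.-tuple Y -> n.+1.-tuple E -> R)
  (Psit : forall p n, n.-tuple Y -> (minn n.+1 p).-tuple E -> R)
  (phin an bn : forall n, n.-tuple Y -> R) (tau : R) (p0 : nat).
Arguments Psi : clear implicits.

Lemma potential_bdm n (y : n.+1.-tuple Y) : potential Psi ->
  hypothesis3 Psi Psit an bn p0 -> bdm (Psi n.+1 y).
Proof.
move=> hPsi h3; have [mPsi _] := hPsi n.+1 isT; split.
  apply: (measurableT_comp (f := fun yx : n.+1.-tuple Y * n.+2.-tuple E =>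
    Psi n.+1 yx.1 yx.2) mPsi (pair1_measurable y)).
have [a1 b1 h] := h3 n.+1 y isT.
exists (bn y) => x; have [/andP[h1 h2] _] := h x.
by rewrite ger0_norm// (le_trans _ h1)// invr_ge0 (le_trans ler01).
Qed.

Lemma potential_lb n (y : n.+1.-tuple Y) : hypothesis3 Psi Psit an bn p0 ->
  exists2 l, 0 < l & forall x, l <= Psi n.+1 y x.
Proof.
move=> h3; have [a1 b1 h] := h3 n.+1 y isT.
exists (an y)^-1; first by rewrite invr_gt0 (lt_le_trans ltr01).
by move=> x; have [/andP[]] := h x.
Qed.

Lemma potential_ratio c n (y : n.+1.-tuple Y) x x' :
  hypothesis3 Psi Psit an bn p0 -> an y * bn y <= c ->
  Psi n.+1 y x <= c * Psi n.+1 y x'.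
Proof.
move=> h3 hc; have [a1 b1 h] := h3 n.+1 y isT.
have [/andP[_ hx] _] := h x; have [/andP[hx' _] _] := h x'.
have a0 := lt_le_trans ltr01 a1; have b0 := lt_le_trans ltr01 b1.
apply: le_trans hx _; apply: (@le_trans _ _ (an y * bn y * (an y)^-1)).
  by rewrite mulrAC divff ?mul1r// gt_eqF.
apply: ler_pM => //; first by rewrite mulr_ge0// ltW.
by rewrite invr_ge0 ltW.
Qed.

(** Both paths share the window, hence the truncated potential; going from [Psi] to it and back
    costs 1 + phi tau^q each way. *)
Lemma potential_agree phi n q (y : n.+1.-tuple Y) (x x' : n.+2.-tuple E) :
  potential Psi -> hypothesis2 Psi Psit phin tau p0 -> phin y <= phi ->
  (p0 <= q)%N -> agree q x x' ->
  Psi n.+1 y x <= (1 + phi * tau ^+ q) ^+ 2 * Psi n.+1 y x'.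
Proof.
move=> hPsi [/andP[t0 t1] phin0 h _] hphi p0q hx.
have [_ Psi0] := hPsi n.+1 isT.
have phi0 : 0 <= phi := le_trans (ltW (phin0 n.+1 y isT)) hphi.
have s1 : 1 <= 1 + phi * tau ^+ q by rewrite lerDl mulr_ge0 ?exprn_ge0// ltW.
(* The paths have n + 2 states, so they coincide if q > n + 1. *)
have [qn|nq] := leqP q n.+1; last first.
  rewrite (agree_all nq hx) ler_peMl//; first exact: ltW.
  by rewrite exprn_ege1.
have [_ {}h] := h q n.+1 y p0q isT qn.
have hw := agree_window hx.
set s := 1 + phi * tau ^+ q in s1 *.
have hle a b : `|a - b| <= phin y * tau ^+ q * Num.min a b -> 0 < a ->
    a <= s * b /\ b <= s * a.
  move=> hab a0; have tq : 0 < tau ^+ q by rewrite exprn_gt0.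
  have pt : phin y * tau ^+ q <= phi * tau ^+ q by rewrite ler_pM2r.
  have pp := phin0 n.+1 y isT.
  have pt0 : 0 < phin y * tau ^+ q by rewrite mulr_gt0.
  (* An absolute value bounds it from below up to a positive factor; this sign lets [phin y] be
     raised to [phi]. *)
  have m0 : 0 <= Num.min a b by rewrite -(pmulr_rge0 _ pt0) (le_trans _ hab).
  have ma : Num.min a b <= a by rewrite ge_min lexx.
  have mb : Num.min a b <= b by rewrite ge_min lexx orbT.
  have {}hab : `|a - b| <= phi * tau ^+ q * Num.min a b.
    by apply: le_trans hab _; rewrite ler_wpM2r.
  have ptp : 0 <= phi * tau ^+ q by rewrite mulr_ge0// ltW.
  have h1 : phi * tau ^+ q * Num.min a b <= phi * tau ^+ q * a by rewrite ler_wpM2l.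
  have h2 : phi * tau ^+ q * Num.min a b <= phi * tau ^+ q * b by rewrite ler_wpM2l.
  move: hab; rewrite ler_norml => /andP[h3 h4].
  by rewrite /s !mulrDl !mul1r; split; lra.
have [hx1 _] := hle _ _ (h x) (Psi0 y x).
have [_ hx2] := hle _ _ (h x') (Psi0 y x').
apply: le_trans hx1 _; rewrite hw expr2 -mulrA ler_wpM2l//.
exact: le_trans ler01 s1.
Qed.

End hypotheses.

Theorem corollary8 (R : realType) (d dY dO : measure_display)
  (E : completeMetricMeasurableType R d) (hE : separable_borel E)
  (Y : measurableType dY) (Omega : measurableType dO)
  (P : probability Omega R)
  (zeta : probability E R) (Q : nat -> R.-pker E ~> E)
  (nu : nat -> {sigma_finite_measure set Y -> \bar R})
  (Psi : forall n : nat, n.-tuple Y -> n.+1.-tuple E -> R)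
  (Psit : forall p n : nat, n.-tuple Y -> (minn n.+1 p).-tuple E -> R)
  (Lambda : nat -> Omega -> E) (Yobs : nat -> Omega -> Y)
  (epsn : nat -> R) (phin an bn : forall n : nat, n.-tuple Y -> R)
  (tau : R) (p0 : nat)
  (hPsi : potential Psi)
  (hmodel : observed_chain P zeta Q nu Psi Lambda Yobs)
  (h1 : hypothesis1 Q epsn)
  (h2 : hypothesis2 Psi Psit phin tau p0)
  (h3 : hypothesis3 Psi Psit an bn p0)
  (c eps phi : R) (hc : 0 < c) (heps : 0 < eps) (hphi : 0 < phi)
  (hbounds : {ae P, forall w, forall n : nat, (0 < n)%N ->
     [/\ an n (from1 (Yobs ^~ w) n) * bn n (from1 (Yobs ^~ w) n) <= c,
         eps <= epsn n &
         phin n (from1 (Yobs ^~ w) n) <= phi]})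
  (htau : tau * c ^+ 3 < 1) :
  exists N0 : nat, forall N : nat, (N0 <= N)%N ->
  forall n : nat, (0 < n)%N ->
  {ae P, forall w,
    (particle_error zeta Q (fun k => Psi k (from1 (Yobs ^~ w) k))
       N (bound_p c phi tau N) n <=
     (bound_C c eps phi tau * (ln N%:R + bound_D c phi tau) *
      (1 / Num.sqrt N%:R) `^ (1 + 3 * ln c / ln tau))%:E)%E}.
Proof.
have [tau01 _ _ _] := h2.
(* As a_n b_n >= 1, the assumed bounds are contradictory at every outcome if c < 1. *)
have [c1|c1] := leP 1 c; last first.
  exists 0%N => N _ n _; apply: filterS hbounds => w /(_ 1%N isT)[hab _ _].
  have [a1 b1 _] := h3 1%N (from1 (Yobs ^~ w) 1) isT.
  by have := le_lt_trans (le_trans (mulr_ege1 a1 b1) hab) c1; rewrite ltxx.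
(* [G], and with it the threshold [N0], is fixed before [n] and [w], hence depends on neither. *)
have [G [G0 Gc hG]] := memory_constant tau01 c1 hphi p0.
pose X := tau / (1 - tau) + 2 * tau / (1 - tau) ^+ 2.
have [N0 hN0] := eventually_bound X tau01 c1 heps hphi Gc.
exists N0 => N /hN0[]; case: N => // M _ hM n _.
apply: filterS hbounds => w hw.
pose y k := from1 (Yobs ^~ w) k.
have eps1 : eps <= 1.
  have [_ h _] := hw 1%N isT; have [/andP[_ h'] _] := h1 1%N isT.
  exact/ltW/(le_lt_trans h h').
have hmix := mean_kernel_mix h1 heps (fun k k0 => let: And3 _ h _ := hw k k0 in h).
apply: le_trans (particle_error_exp_le (Psi := fun k => Psi k (y k)) zeta
  _ _ n (bound_p c phi tau M.+1) M heps eps1 hmix hc _ G0 tau01 _) _.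
- by move=> k; exact: potential_bdm hPsi h3.
- by move=> k; exact: potential_lb h3.
- by move=> k x x'; apply: potential_ratio h3 _; have [] := hw k.+1 isT.
- move=> k q x x' hx; have [hab _ hph] := hw k.+1 isT.
  have Psi0 : 0 <= Psi k.+1 (y k.+1) x' by have [_ /(_ _ _)/ltW] := hPsi k.+1 isT.
  have [hc'|[pq hs]] := hG q.
    by apply: le_trans (potential_ratio x x' h3 hab) _; rewrite ler_wpM2r.
  by apply: le_trans (potential_agree hPsi h2 hph pq hx) _; rewrite ler_wpM2r.
by rewrite lee_fin.
Qed.
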